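(* Let $R$ be a finite lattice with Coxeter matrix $C$, where the elements of $R$ (indexing rows and columns of $C$) are ordered according to a linear extension of the order on $R$. Then $R$ is distributive if and only if the first (leftmost) non-zero entries of the rows of $C$ lie in pairwise different columns. In this case, $C$ admits a Bruhat decomposition $C=U_1PU_2$ in which $U_1$ is the identity matrix, and the Coxeter permutation given by $P$ coincides with the grade bijection of the incidence algebra of $R$.
   Context: For a finite poset $R$ and a field $K$, the incidence algebra $A=KR$ has $K$-basis $\{p_{x,y}\mid x\le y\}$ with $p_{x,y}p_{y',z}=p_{x,z}$ if $y=y'$ and $0$ otherwise; its primitive idempotents are $e_x=p_{x,x}$, and modules are finitely generated right modules. Its Cartan matrix $\omega$ has $(x,y)$ entry $\dim_K e_yAe_x$, which is $1$ if $y\le x$ and $0$ otherwise. The Coxeter matrix of $R$ is $C=-\omega^T\omega^{-1}$ (an integer matrix independent of $K$). A linear extension is a total ordering of the elements such that if $x<y$ in $R$ then $x$ comes before $y$. A Bruhat decomposition of an invertible real matrix $M$ is a factorisation $M=U_1PU_2$ with $P$ a permutation matrix and $U_1,U_2$ upper triangular; $P$ is uniquely determined by $M$. A permutation matrix $P$ is identified with the permutation sending $i$ to the index of the unique row having a non-zero entry in the $i$-th column; for $M=C$ this is called the Coxeter permutation. When $R$ is distributive, $A=KR$ is known to be Auslander regular (with $0\to A\to I^0\to I^1\to\cdots$ a minimal injective coresolution: $\operatorname{pdim} I^i\le i$ for all $i$, $\operatorname{idim}A<\infty$, and finite global dimension), and the grade bijection is then the (known to be well-defined) bijection $\phi(S)=\operatorname{top}\big(D\operatorname{Ext}_A^{g_S}(S,A)\big)$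 on isomorphism classes of simple $A$-modules, where $D=\operatorname{Hom}_K(-,K)$ and $g_S=\inf\{i\ge0\mid \operatorname{Ext}^i_A(S,A)\neq0\}$; it is regarded as a permutation of $R$ via $x\leftrightarrow S(x)$, where $S(x)$ is the simple top of $P(x)=e_xA$. *)

(* Defs.v *)
From HB Require Import structures.
From mathcomp Require Import all_boot all_order perm all_algebra.
From mathcomp Require Import boolp functions.

Set Implicit Arguments.
Unset Strict Implicit.
Unset Printing Implicit Defensive.

Import Order.TTheory GRing.Theory.
Local Open Scope ring_scope.

(* An [lmodType A] is a left A-module; a right A-module is an [lmodType A^c],  *)
(* where A^c is the opposite ring: for [a : A^c], [a *: v] reads "v . a".      *)

Section Modules.
Variable A : pzRingType.

Definition isomorphic (U V : lmodType A) : Prop :=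
  exists f : {linear U -> V}, bijective f.

Section Submodules.
Variable V : lmodType A.

Section OneSubmodule.
Variable W : submodClosed V.

Definition submod := {v : V | v \in (W : {pred V})}.
HB.instance Definition _ := SubType.on submod.
HB.instance Definition _ := [Choice of submod by <:].
HB.instance Definition _ := [SubChoice_isSubLmodule of submod by <:].

(* [submodClosed] only records closure under 0, + and scaling; [Quotient.quot] *)
(* also needs closure under opposite.                                          *)
Definition submod_pred : {pred V} := W.
Fact submod_pred_closed : zmod_closed submod_pred.
Proof. exact: (GRing.subsemimod_closedB (GRing.submodClosedP W)). Qed.
HB.instance Definition _ :=
  GRing.isZmodClosed.Build V submod_pred submod_pred_closed.

Definition quotmod := Quotient.quot submod_pred.
HB.instance Definition _ := GRing.Zmodule.on quotmod.

Definition quot_pi (v : V) : quotmod := (\pi_(Quotient.quot submod_pred) v)%qT.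

Fact quot_piD u v : quot_pi (u + v) = quot_pi u + quot_pi v.
Proof. by rewrite /quot_pi raddfD. Qed.

Fact quot_pi_repr (v : quotmod) : quot_pi (repr v) = v.
Proof. exact: reprK. Qed.

Definition quotmod_scale (a : A) (v : quotmod) : quotmod :=
  quot_pi (a *: repr v).

Fact quotmod_scaleE a v : quotmod_scale a (quot_pi v) = quot_pi (a *: v).
Proof.
apply/eqP; rewrite -Quotient.idealrBE -scalerBr.
have: repr (quot_pi v) - v \in submod_pred.
  by rewrite Quotient.idealrBE; apply/eqP/quot_pi_repr.
exact: rpredZ.
Qed.

Fact quotmod_scaleA a b v :
  quotmod_scale a (quotmod_scale b v) = quotmod_scale (a * b) v.
Proof. by rewrite -[v]quot_pi_repr !quotmod_scaleE scalerA. Qed.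

Fact quotmod_scale1 : left_id 1 quotmod_scale.
Proof. by move=> v; rewrite -[v]quot_pi_repr quotmod_scaleE scale1r. Qed.

Fact quotmod_scaleDr : right_distributive quotmod_scale +%R.
Proof.
move=> a u v; rewrite -[u]quot_pi_repr -[v]quot_pi_repr.
by rewrite -quot_piD !quotmod_scaleE -quot_piD scalerDr.
Qed.

Fact quotmod_scaleDl v : {morph quotmod_scale^~ v : a b / a + b}.
Proof.
move=> a b; rewrite -[v]quot_pi_repr.
by rewrite !quotmod_scaleE -quot_piD scalerDl.
Qed.

HB.instance Definition _ := GRing.Zmodule_isLmodule.Build A quotmod
  quotmod_scaleA quotmod_scale1 quotmod_scaleDr quotmod_scaleDl.

Definition maximal_submod : Prop :=
  (exists v, v \notin W) /\
  forall W' : submodClosed V,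
    {subset W <= W'} -> (exists v, v \notin W') -> {subset W' <= W}.

End OneSubmodule.

Definition rad : {pred V} := fun v =>
  `[< forall W : submodClosed V, maximal_submod W -> v \in W >].

Fact rad_submod_closed : submod_closed rad.
Proof.
split=> [|a u v /asboolP ru /asboolP rv]; apply/asboolP=> W maxW.
  exact: rpred0.
by rewrite rpredD ?rpredZ ?ru ?rv.
Qed.
HB.instance Definition _ := GRing.isSubmodClosed.Build A V rad rad_submod_closed.

Definition top : lmodType A := quotmod rad.

End Submodules.

Definition projective (P : lmodType A) : Prop :=
  forall (U V : lmodType A) (p : {linear U -> V}) (f : {linear P -> V}),
    (forall v, exists u, p u = v) ->
    exists g : {linear P -> U}, forall x, p (g x) = f x.

Record proj_resolution (M : lmodType A) := ProjResolution {
  res_mod : nat -> lmodType A;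
  res_diff : forall n, {linear res_mod n.+1 -> res_mod n};
  res_aug : {linear res_mod 0%N -> M};
  res_projective : forall n, projective (res_mod n);
  res_aug_surj : forall m, exists x, res_aug x = m;
  res_exact0 : forall x, res_aug x = 0 <-> exists y, res_diff 0%N y = x;
  res_exact : forall n x,
    res_diff n x = 0 <-> exists y, res_diff n.+1 y = x
}.

End Modules.

Section Ext.
Variable A : pzRingType.

(* Hom_A(M, A) for a right module M, with its left module structure            *)
(* (a . f)(m) = a * f m.                                                       *)
Section Hom.
Variable M : lmodType A^c.

Definition homA_pred : {pred M -> A^o} := fun f =>
  `[< forall (a : A) (u v : M), f ((a : A^c) *: u + v) = f u * a + f v >].

Fact homA_submod_closed : submod_closed homA_pred.
Proof.
split=> [|b f g /asboolP hf /asboolP hg]; apply/asboolP=> a u v.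
  by rewrite mul0r addr0.
change (b * f ((a : A^c) *: u + v) + g ((a : A^c) *: u + v) =
  (b * f u + g u) * a + (b * f v + g v)).
by rewrite hf hg mulrDr mulrDl mulrA !addrA (addrAC (b * f u * a)).
Qed.
HB.instance Definition _ :=
  GRing.isSubmodClosed.Build A (M -> A^o) homA_pred homA_submod_closed.

Definition homA : lmodType A := submod homA_pred.

End Hom.

Section Cohomology.
Variables (M : lmodType A^c) (P : proj_resolution M).

Definition cocycle n : {pred homA (res_mod P n)} := fun f =>
  `[< forall v, val f (res_diff P n v) = 0 >].

Definition coboundary n : {pred homA (res_mod P n)} :=
  match n with
  | 0 => fun f => f == 0
  | n'.+1 => fun f =>
    `[< exists g : homA (res_mod P n'),
          forall v, val f v = val g (res_diff P n' v) >]
  end.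

Fact cocycle_submod_closed n : submod_closed (@cocycle n).
Proof.
split=> [|a f g /asboolP hf /asboolP hg]; apply/asboolP=> v //.
by rewrite /= -[LHS]/(a *: val f _ + val g _) hf hg scaler0 addr0.
Qed.
HB.instance Definition _ n := GRing.isSubmodClosed.Build A _ (@cocycle n)
  (@cocycle_submod_closed n).

Fact coboundary_submod_closed n : submod_closed (@coboundary n).
Proof.
case: n => [|n]; split.
- exact: eqxx.
- by move=> a f g /eqP-> /eqP->; apply/eqP; rewrite scaler0 addr0.
- by apply/asboolP; exists 0.
move=> a f g /asboolP[f' hf] /asboolP[g' hg]; apply/asboolP.
by exists (a *: f' + g') => v; rewrite /= -[LHS]/(a *: val f v + val g v) hf hg.
Qed.
HB.instance Definition _ n := GRing.isSubmodClosed.Build A _ (@coboundary n)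
  (@coboundary_submod_closed n).

Definition coboundary_in n : {pred submod (@cocycle n)} := fun f =>
  val f \in @coboundary n.

Fact coboundary_in_submod_closed n : submod_closed (@coboundary_in n).
Proof.
split=> [|a f g hf hg]; rewrite /in_mem /= /coboundary_in.
  exact: rpred0.
by rewrite rpredD ?rpredZ.
Qed.
HB.instance Definition _ n := GRing.isSubmodClosed.Build A _ (@coboundary_in n)
  (@coboundary_in_submod_closed n).

Definition Ext n : lmodType A := quotmod (@coboundary_in n).

Definition is_grade g : Prop :=
  (exists e : Ext g, e != 0) /\
  forall i, (i < g)%N -> forall e : Ext i, e = 0.

End Cohomology.
End Ext.

Section IncidenceAlgebra.
Variables (K : fieldType) (d : Order.disp_t) (R : finPOrderType d).

(* An element sum_(x <= y) a_(x,y) p_(x,y) of KR is represented by the         *)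
(* function (x, y) |-> a_(x,y), zero off the order relation.                   *)
Definition incidence_pred : {pred {ffun R * R -> K^o}} := fun f =>
  [forall x, forall y, ~~ (x <= y)%O ==> (f (x, y) == 0)].

Fact incidence_predP (f : {ffun R * R -> K^o}) :
  reflect (forall x y, ~~ (x <= y)%O -> f (x, y) = 0) (f \in incidence_pred).
Proof.
apply: (iffP forallP) => [h x y nxy | h x].
  by move/forallP: (h x) => /(_ y); rewrite nxy => /eqP.
by apply/forallP=> y; apply/implyP=> nxy; apply/eqP/h.
Qed.

Fact incidence_submod_closed : submod_closed incidence_pred.
Proof.
split=> [|a f g /incidence_predP hf /incidence_predP hg];
  apply/incidence_predP => x y nxy; rewrite !ffunE //.
by rewrite hf // hg // scaler0 addr0.
Qed.
HB.instance Definition _ := GRing.isSubmodClosed.Build K {ffun R * R -> K^o}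
  incidence_pred incidence_submod_closed.

Definition incidence_alg := {f : {ffun R * R -> K^o} | f \in incidence_pred}.
HB.instance Definition _ := SubType.on incidence_alg.
HB.instance Definition _ := [Choice of incidence_alg by <:].
HB.instance Definition _ := [SubChoice_isSubLmodule of incidence_alg by <:].

Implicit Types a b c : incidence_alg.

Lemma incidence_eq0 a x y : ~~ (x <= y)%O -> val a (x, y) = 0.
Proof. exact/incidence_predP/valP. Qed.

Lemma incidence_ext a b :
  (forall x y, val a (x, y) = val b (x, y)) -> a = b.
Proof. by move=> ab; apply/val_inj/ffunP => -[x y]. Qed.

Definition inc_mul_fun a b : {ffun R * R -> K^o} :=
  [ffun p => \sum_y val a (p.1, y) * val b (y, p.2)].

Fact inc_mul_subproof a b : inc_mul_fun a b \in incidence_pred.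
Proof.
apply/incidence_predP=> x z nxz; rewrite ffunE big1 //= => y _.
have [xy|nxy] := boolP (x <= y)%O; last by rewrite incidence_eq0 ?mul0r.
rewrite [X in _ * X]incidence_eq0 ?mulr0 //.
by apply: contra nxz; exact: le_trans.
Qed.

Definition inc_mul a b : incidence_alg := @exist _ (fun f => f \in incidence_pred) _ (inc_mul_subproof a b).

Definition inc_one_fun : {ffun R * R -> K^o} := [ffun p => (p.1 == p.2)%:R].

Fact inc_one_subproof : inc_one_fun \in incidence_pred.
Proof.
by apply/incidence_predP=> x y; rewrite ffunE /=; case: eqP => [->|//]; rewrite lexx.
Qed.

Definition inc_one : incidence_alg := @exist _ (fun f => f \in incidence_pred) _ inc_one_subproof.

Lemma inc_mulE a b x z :
  val (inc_mul a b) (x, z) = \sum_y val a (x, y) * val b (y, z).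
Proof. by rewrite /= ffunE. Qed.

Lemma inc_oneE x y : val inc_one (x, y) = (x == y)%:R.
Proof. by rewrite /= ffunE. Qed.

Lemma inc_addE a b p : val (a + b) p = val a p + val b p.
Proof. exact: ffunE. Qed.

Lemma inc_scaleE (k : K) a p : val (k *: a) p = k * val a p.
Proof. exact: ffunE. Qed.

Fact inc_mulA : associative inc_mul.
Proof.
move=> a b c; apply: incidence_ext => x w; rewrite !inc_mulE.
under eq_bigr do rewrite inc_mulE mulr_sumr.
rewrite exchange_big; apply: eq_bigr => z _.
by rewrite inc_mulE mulr_suml; apply: eq_bigr => y _; rewrite mulrA.
Qed.

Fact inc_mul1 : left_id inc_one inc_mul.
Proof.
move=> a; apply: incidence_ext => x z; rewrite inc_mulE (bigD1 x) //= big1.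
  by rewrite ffunE eqxx mul1r addr0.
by move=> y nyx; rewrite ffunE /= eq_sym (negPf nyx) mul0r.
Qed.

Fact inc_mulr1 : right_id inc_one inc_mul.
Proof.
move=> a; apply: incidence_ext => x z; rewrite inc_mulE (bigD1 z) //= big1.
  by rewrite ffunE eqxx mulr1 addr0.
by move=> y nyx; rewrite ffunE /= (negPf nyx) mulr0.
Qed.

Fact inc_mulDl : left_distributive inc_mul +%R.
Proof.
move=> a b c; apply: incidence_ext => x z; rewrite inc_addE !inc_mulE -big_split.
by apply: eq_bigr => y _; rewrite inc_addE mulrDl.
Qed.

Fact inc_mulDr : right_distributive inc_mul +%R.
Proof.
move=> a b c; apply: incidence_ext => x z; rewrite inc_addE !inc_mulE -big_split.
by apply: eq_bigr => y _; rewrite inc_addE mulrDr.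
Qed.

HB.instance Definition _ := GRing.Zmodule_isPzRing.Build incidence_alg
  inc_mulA inc_mul1 inc_mulr1 inc_mulDl inc_mulDr.

Lemma inc_scalerAl (k : K) a b : k *: (a * b) = (k *: a) * b.
Proof.
apply: incidence_ext => x z; rewrite inc_scaleE !inc_mulE mulr_sumr.
by apply: eq_bigr => y _; rewrite inc_scaleE mulrA.
Qed.

Lemma inc_scalerAr (k : K) a b : k *: (a * b) = a * (k *: b).
Proof.
apply: incidence_ext => x z; rewrite inc_scaleE !inc_mulE mulr_sumr.
by apply: eq_bigr => y _; rewrite inc_scaleE mulrCA.
Qed.

Definition inc_idem_fun x : {ffun R * R -> K^o} := [ffun p => (p == (x, x))%:R].

Fact inc_idem_subproof x : inc_idem_fun x \in incidence_pred.
Proof.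
apply/incidence_predP=> y z; rewrite ffunE.
by case: eqP => // -[-> ->]; rewrite lexx.
Qed.

Definition inc_idem x : incidence_alg := @exist _ (fun f => f \in incidence_pred) _ (inc_idem_subproof x).

End IncidenceAlgebra.

Section Simple.
Variables (K : fieldType) (d : Order.disp_t) (R : finPOrderType d).
Notation A := (incidence_alg K R).

(* e_x A inside the regular right module. *)
Definition proj_pred (x : R) : {pred (A^c)^o} := fun a =>
  `[< exists b : A, (a : A) = inc_idem K x * b >].

Fact proj_submod_closed x : submod_closed (proj_pred x).
Proof.
split=> [|c a b /asboolP[a' ea] /asboolP[b' eb]]; apply/asboolP.
  by exists 0; rewrite mulr0.
exists (a' * c + b'); rewrite mulrDr mulrA.
by change ((a : A) * c + b = inc_idem K x * a' * c + inc_idem K x * b'); congr (_ * _ + _).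
Qed.
HB.instance Definition _ x := GRing.isSubmodClosed.Build A^c (A^c)^o
  (proj_pred x) (proj_submod_closed x).

Definition indec_proj x : lmodType A^c := submod (proj_pred x).

Definition simple_mod x : lmodType A^c := top (indec_proj x).

End Simple.

Section Duality.
Variables (K : fieldType) (d : Order.disp_t) (R : finPOrderType d).
Notation A := (incidence_alg K R).
Variable E : lmodType A.

(* D E = Hom_K(E, K), where K acts on the left A-module E through k |-> k . 1. *)
Definition dual_pred : {pred E -> K} := fun phi =>
  `[< forall (k : K) (u v : E),
        phi ((k *: (1 : A)) *: u + v) = k * phi u + phi v >].

Fact dual_zmod_closed : zmod_closed dual_pred.
Proof.
split=> [|f g /asboolP hf /asboolP hg]; apply/asboolP=> k u v.
  by rewrite mulr0 addr0.
rewrite -[LHS]/(f _ - g _) hf hg -[(f - g) u]/(f u - g u).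
by rewrite -[(f - g) v]/(f v - g v) mulrBr opprD addrACA.
Qed.
HB.instance Definition _ := GRing.isZmodClosed.Build (E -> K) dual_pred
  dual_zmod_closed.

Definition dual := {phi : E -> K | phi \in dual_pred}.
HB.instance Definition _ := SubType.on dual.
HB.instance Definition _ := [Choice of dual by <:].
HB.instance Definition _ := [SubChoice_isSubZmodule of dual by <:].

Fact dual_scale_subproof (a : A) (phi : dual) :
  (fun e => val phi (a *: e)) \in dual_pred.
Proof.
apply/asboolP=> k u v; have /asboolP <- := valP phi.
by rewrite scalerDr !scalerA -inc_scalerAl -inc_scalerAr mulr1 mul1r.
Qed.

(* The right module structure (phi . a)(e) = phi (a . e). *)
Definition dual_scale (a : A^c) (phi : dual) : dual :=
  @exist _ (fun phi => phi \in dual_pred) _ (dual_scale_subproof a phi).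

Fact dual_scaleA a b phi :
  dual_scale a (dual_scale b phi) = dual_scale (a * b) phi.
Proof. by apply/val_inj/funext=> e /=; rewrite scalerA. Qed.

Fact dual_scale1 : left_id 1 dual_scale.
Proof. by move=> phi; apply/val_inj/funext=> e /=; rewrite scale1r. Qed.

Fact dual_scaleDr : right_distributive dual_scale +%R.
Proof. by move=> a phi psi; apply/val_inj/funext. Qed.

Fact dual_scaleDl phi : {morph dual_scale^~ phi : a b / a + b}.
Proof.
move=> a b; apply/val_inj/funext=> e /=.
have /asboolP/(_ 1 ((a : A) *: e) ((b : A) *: e)) := valP phi.
by rewrite scale1r scale1r mul1r scalerDl => ->.
Qed.

HB.instance Definition _ := GRing.Zmodule_isLmodule.Build A^c dual
  dual_scaleA dual_scale1 dual_scaleDr dual_scaleDl.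

End Duality.

Section GradeBijection.
Variables (K : fieldType) (d : Order.disp_t) (R : finPOrderType d).

(* phi(S(x)) = S(y). Ext is only defined up to isomorphism, through a choice   *)
(* of projective resolution; the description of phi is required for every      *)
(* choice (and some choice must exist).                                        *)
Definition grade_image (x y : R) : Prop :=
  inhabited (proj_resolution (simple_mod K x)) /\
  forall P : proj_resolution (simple_mod K x),
    exists g, is_grade P g /\
      isomorphic (top (dual (Ext P g))) (simple_mod K y).

Definition is_grade_bijection (phi : {perm R}) : Prop :=
  forall x, grade_image x (phi x).

End GradeBijection.

Section CoxeterMatrix.
Variables (d : Order.disp_t) (R : finPOrderType d) (n : nat) (s : 'I_n -> R).

(* s lists all the elements of R, each of them once. *)
Definition linear_extension : Prop :=
  bijective s /\ forall i j : 'I_n, (s i < s j)%O -> (i < j)%N.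

Definition cartan_mx : 'M[int]_n := \matrix_(i, j) (s j <= s i)%O%:R.

Definition coxeter_mx : 'M[int]_n := - (cartan_mx^T *m invmx cartan_mx).

End CoxeterMatrix.

Definition first_nonzero (V : nmodType) (n : nat) (M : 'M[V]_n) (i j : 'I_n) :=
  (M i j != 0) && [forall k : 'I_n, (k < j)%N ==> (M i k == 0)].

Definition leading_columns_distinct (V : nmodType) (n : nat) (M : 'M[V]_n) :=
  forall i1 i2 j1 j2 : 'I_n, i1 != i2 ->
    first_nonzero M i1 j1 -> first_nonzero M i2 j2 -> j1 != j2.

(* [is_trig_mx] means lower triangular. *)
Definition upper_triangular (F : fieldType) (n : nat) (U : 'M[F]_n) :=
  is_trig_mx U^T.

Definition bruhat_decomposition (F : fieldType) (n : nat)
    (M U1 P U2 : 'M[F]_n) : Prop :=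
  [/\ upper_triangular U1, is_perm_mx P, upper_triangular U2
    & M = U1 *m P *m U2].

(* pi i is the row of the non-zero entry of column i; with MathComp's          *)
(* convention for [perm_mx] this reads P = perm_mx pi^-1.                      *)
Definition col_perm_of (F : fieldType) (n : nat) (P : 'M[F]_n) (pi : 'S_n) :=
  forall i, P (pi i) i != 0.

Definition distributive_lattice (d : Order.disp_t) (R : latticeType d) : Prop :=
  forall x y z : R,
    Order.meet x (Order.join y z) =
    Order.join (Order.meet x y) (Order.meet x z).

(* Main.v *)
(* Write 1_(>= x) for the indicator of a principal filter. The row of C indexed
   by x is characterised by 1_(>= x) = - sum_y C_(x,y) 1_(<= y), and C_(x,y) can
   only be nonzero when y is a meet of maximal elements of {m | x </= m}.

   If the leading entries of C lie in different columns, then, going down along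
   the linear extension, every such maximal element w is prime, i.e. the
   complement of its principal ideal is a principal filter: the row x whose
   leading column is w cannot involve a second maximal element m, since a nonzero
   coefficient at w `&` m would come before w. A lattice in which all these
   elements are prime is distributive.

   Conversely, if R is distributive, the row of x is supported above the meet
   rowmotion x of all maximal elements not above x. Rowmotion is inverse to
   corowmotion x, the join of the set S of minimal elements not below x; hence
   permuting the rows of C by corowmotion makes it upper triangular, and its
   diagonal is nonzero because C is invertible.

   The simple module S(x) has a Koszul resolution with terms
   P(x `|` \join I), I a subset of S. Since the elements of S are join-prime, the
   component of Hom(-, A) at z is acyclic unless all p in S lie below z, so Ext
   is concentrated in degree #|S|, where it is the interval module on
   [corowmotion x, x `|` \join S]; the top of its dual is S(corowmotion x). *)

From HB Require Import structures.
From mathcomp Require Import all_boot all_order perm all_algebra.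
From mathcomp Require Import boolp functions.
Require Import Defs.

Set Implicit Arguments.
Unset Strict Implicit.
Unset Printing Implicit Defensive.

Import Order.TTheory GRing.Theory.
Local Open Scope ring_scope.

(** * Modules over a ring *)

Section Modules.
Variable A : pzRingType.

Definition Linear (U V : lmodType A) (f : U -> V) (fL : linear f) :
  {linear U -> V} := HB.pack f (GRing.isLinear.Build _ _ _ _ f fL).

Definition Submod (V : lmodType A) (W : submodClosed V) (v : V) (vW : v \in W) :
  submod W := exist _ v vW.
Arguments Submod {V} W {v} vW.

Lemma Submod_linear (V : lmodType A) (W : submodClosed V) a (u v : V)
    (uW : u \in W) (vW : v \in W) (uvW : a *: u + v \in W) :
  Submod W uvW = a *: Submod W uW + Submod W vW.
Proof. by apply: val_inj; rewrite linearP. Qed.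

Lemma quot_pi_eq0 (V : lmodType A) (W : submodClosed V) (v : V) :
  quot_pi W v = 0 <-> v \in W.
Proof.
have -> : 0 = quot_pi W 0 by exact: esym (raddf0 _).
rewrite -[v in _ <-> v \in _]subr0 -[_ \in W]/(v - 0 \in submod_pred W).
by rewrite Quotient.idealrBE; split=> /eqP.
Qed.

Lemma quot_piB (V : lmodType A) (W : submodClosed V) (u v : V) :
  quot_pi W u = quot_pi W v <-> u - v \in W.
Proof.
rewrite -quot_pi_eq0 /quot_pi raddfB; split=> [/eqP|/eqP].
  by rewrite -subr_eq0 => /eqP.
by rewrite subr_eq0 => /eqP.
Qed.

Lemma quot_piZ (V : lmodType A) (W : submodClosed V) a (v : V) :
  quot_pi W (a *: v) = a *: quot_pi W v.
Proof. by rewrite -[RHS]/(quotmod_scale a _) quotmod_scaleE. Qed.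

Lemma quotmod_induced (V V' : lmodType A) (W : submodClosed V)
    (W' : submodClosed V') (h : {linear V -> V'}) :
  (forall v, v \in W -> h v \in W') ->
  exists H : {linear quotmod W -> quotmod W'},
    forall v, H (quot_pi W v) = quot_pi W' (h v).
Proof.
move=> hW; pose H (v : quotmod W) := quot_pi W' (h (repr v)).
have HE v : H (quot_pi W v) = quot_pi W' (h v).
  rewrite /H quot_piB -raddfB; apply: hW; rewrite -quot_piB; exact: quot_pi_repr.
have HL : linear H.
  move=> a u v; rewrite -[u]quot_pi_repr -[v]quot_pi_repr.
  by rewrite -quot_piZ -quot_piD !HE linearP quot_piD quot_piZ.
by exists (Linear HL).
Qed.

End Modules.
Arguments Submod {A V} W {v} vW.

(** * Comparison of projective resolutions *)

Section Comparison.
Variable B : pzRingType.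

Section Lift.
Variables (U V : lmodType B) (p : {linear U -> V}).

Definition linear_kernel : {pred U} := fun u => p u == 0.

Fact linear_kernel_submod_closed : submod_closed linear_kernel.
Proof.
split=> [|a u v /eqP pu /eqP pv]; apply/eqP; first exact: raddf0.
by rewrite linearP pu pv scaler0 addr0.
Qed.
HB.instance Definition _ :=
  GRing.isSubmodClosed.Build B U linear_kernel linear_kernel_submod_closed.

Definition corestrict (W : lmodType B) (f : {linear W -> U})
    (pf0 : forall w, p (f w) = 0) (w : W) : submod linear_kernel :=
  @Submod _ _ linear_kernel (f w) (introT eqP (pf0 w)).

Fact corestrict_linear W f pf0 : linear (@corestrict W f pf0).
Proof. by move=> a u v; apply: val_inj; rewrite /= linearP. Qed.

End Lift.

(** Projectivity lifts along surjections only. Exactness at [V] makes [p] surjective onto the kernel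
    of [q], and [f] lands in that kernel, so both maps are corestricted to it first. *)
Lemma projective_lift (P U V W : lmodType B) (p : {linear U -> V})
    (q : {linear V -> W}) (f : {linear P -> V}) :
  projective P -> (forall u, q (p u) = 0) ->
  (forall v, q v = 0 -> exists u, p u = v) -> (forall x, q (f x) = 0) ->
  exists g : {linear P -> U}, forall x, p (g x) = f x.
Proof.
move=> projP qp0 exq qf0.
have [v|g gE] := projP _ _ (Linear (corestrict_linear qp0))
  (Linear (corestrict_linear qf0)).
  have [u pu] := exq _ (eqP (valP v)).
  by exists u; apply: val_inj.
by exists g => x; have /(congr1 val) := gE x.
Qed.

Variables M : lmodType B.

(** Puts the augmentation and the differentials under one predicate, so that recursive constructions
    need not single out degree 0. *)
Definition res_cycle (P : proj_resolution M) n : res_mod P n -> Prop :=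
  match n with
  | 0 => fun x => res_aug P x = 0
  | n'.+1 => fun x => res_diff P n' x = 0
  end.

Lemma res_cycleP (P : proj_resolution M) n (x : res_mod P n) :
  res_cycle x <-> exists y, res_diff P n y = x.
Proof. by case: n x => [|n] x; [exact: res_exact0 | exact: res_exact]. Qed.

Lemma res_diffK (P : proj_resolution M) n y :
  res_cycle (res_diff P n y).
Proof. by rewrite res_cycleP; exists y. Qed.

Lemma res_diff_diff (P : proj_resolution M) n y :
  res_diff P n (res_diff P n.+1 y) = 0.
Proof. exact: (res_diffK y). Qed.

Lemma res_lift (P : proj_resolution M) (X : lmodType B) n
    (f : {linear X -> res_mod P n}) :
  projective X -> (forall x, res_cycle (f x)) ->
  exists g : {linear X -> res_mod P n.+1}, forall x, res_diff P n (g x) = f x.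
Proof.
move=> projX; case: n f => [|n] f fK.
  apply: (projective_lift (q := res_aug P)) => // [u|v].
    exact: (res_diffK u).
  by move=> /(res_cycleP (n := 0)).
apply: (projective_lift (q := res_diff P n)) => // [u|v].
  exact: (res_diffK u).
by move=> /(res_cycleP (n := n.+1)).
Qed.

Section ChainMap.
Variables P Q : proj_resolution M.

Lemma chain_map_exists :
  exists f : forall n, {linear res_mod P n -> res_mod Q n},
    (forall x, res_aug Q (f 0%N x) = res_aug P x) /\
    (forall n x, res_diff Q n (f n.+1 x) = f n (res_diff P n x)).
Proof.
(* Invariant carried by the recursion: [f] sends boundaries to cycles, which is exactly what
   [res_lift] needs to produce the next component. [cid] turns that existence into data. *)
pose good n (f : {linear res_mod P n -> res_mod Q n}) :=
  forall x, res_cycle (f (res_diff P n x)).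
have [f0 f0E] :=
  @res_projective _ _ P 0%N _ _ _ (res_aug P) (@res_aug_surj _ _ Q).
have f0g : good 0 f0 by move=> x; rewrite /= f0E; exact: (res_diffK x).
have step n (f : {f | good n f}) :
    {g : {linear res_mod P n.+1 -> res_mod Q n.+1}
    | forall x, res_diff Q n (g x) = sval f (res_diff P n x)}.
  exact/cid/(@res_lift _ _ _ (sval f \o res_diff P n)
    (@res_projective _ _ P n.+1) (svalP f)).
have stepg n f : good n.+1 (sval (step n f)).
  by move=> x; rewrite /= (svalP (step n f)) res_diff_diff raddf0.
pose F := fix F n : {f | good n f} := match n with
  | 0 => exist (good 0%N) f0 f0g
  | n'.+1 => exist (good n'.+1) _ (stepg n' (F n')) end.
exists (fun n => sval (F n)); split=> // n x.
exact: (svalP (step n (F n))).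
Qed.

Lemma chain_homotopy_exists
    (f : forall n, {linear res_mod P n -> res_mod Q n}) :
  (forall x, res_aug Q (f 0%N x) = 0) ->
  (forall n x, res_diff Q n (f n.+1 x) = f n (res_diff P n x)) ->
  exists h : forall n, {linear res_mod P n -> res_mod Q n.+1},
    (forall x, res_diff Q 0%N (h 0%N x) = f 0%N x) /\
    (forall n x, res_diff Q n.+1 (h n.+1 x) = f n.+1 x - h n (res_diff P n x)).
Proof.
move=> f0 fE.
(* This invariant makes [f n.+1 - h n \o d] cycle-valued, since [d f = f d] and [d h d = f d];
   lifting it gives the next component of the homotopy. *)
pose good n (h : {linear res_mod P n -> res_mod Q n.+1}) :=
  forall x, res_diff Q n (h (res_diff P n x)) = f n (res_diff P n x).
have [h0 h0E] := res_lift (@res_projective _ _ P 0%N)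
  (f0 : forall x, res_cycle (f 0%N x)).
have h0g : good 0%N h0 by move=> x; rewrite h0E.
have step n (h : {h | good n h}) :
    {g : {linear res_mod P n.+1 -> res_mod Q n.+2}
    | forall x, res_diff Q n.+1 (g x) = f n.+1 x - sval h (res_diff P n x)}.
  apply/cid/(@res_lift _ _ _ (f n.+1 \- (sval h \o res_diff P n)))=> [|x] /=.
    exact: res_projective.
  by rewrite raddfB /= fE (svalP h) subrr.
have stepg n h : good n.+1 (sval (step n h)).
  by move=> x; rewrite /= (svalP (step n h)) res_diff_diff raddf0 subr0.
pose F := fix F n : {h | good n h} := match n with
  | 0 => exist (good 0%N) h0 h0g
  | n'.+1 => exist (good n'.+1) _ (stepg n' (F n')) end.
exists (fun n => sval (F n)); split=> // n x.
exact: (svalP (step n (F n))).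
Qed.

End ChainMap.
End Comparison.

(** * Independence of Ext from the projective resolution *)

Section ExtIndependence.
Variable A : pzRingType.

Lemma homA_linear (M : lmodType A^c) (f : homA M) (a : A) (u v : M) :
  val f ((a : A^c) *: u + v) = val f u * a + val f v.
Proof. by have /asboolP := valP f; apply. Qed.

Lemma homAD (M : lmodType A^c) (f : homA M) (u v : M) :
  val f (u + v) = val f u + val f v.
Proof. by have := homA_linear f 1 u v; rewrite scale1r mulr1. Qed.

Lemma homA0 (M : lmodType A^c) (f : homA M) : val f 0 = 0.
Proof. by apply: (addrI (val f 0)); rewrite -homAD !addr0. Qed.

Lemma homAZ (M : lmodType A^c) (f : homA M) (a : A) (u : M) :
  val f ((a : A^c) *: u) = val f u * a.
Proof. by rewrite -[_ *: u]addr0 homA_linear homA0 addr0. Qed.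

Lemma homAN (M : lmodType A^c) (f : homA M) (u : M) : val f (- u) = - val f u.
Proof. by apply: (addrI (val f u)); rewrite -homAD !subrr homA0. Qed.

Lemma homA_valD (M : lmodType A^c) (f g : homA M) u :
  val (f + g) u = val f u + val g u.
Proof. by rewrite raddfD. Qed.

Lemma homA_valN (M : lmodType A^c) (f : homA M) u : val (- f) u = - val f u.
Proof. by rewrite raddfN. Qed.

Lemma homA_valZ (M : lmodType A^c) (a : A) (f : homA M) u :
  val (a *: f) u = a * val f u.
Proof. by rewrite linearZ. Qed.

Section Pull.
Variables (M N : lmodType A^c) (h : {linear M -> N}).

Fact hom_pull_subproof (f : homA N) : (val f \o h : M -> A^o) \in @homA_pred A M.
Proof. by apply/asboolP=> a u v; rewrite /= linearP homA_linear. Qed.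

Definition hom_pull_fun (f : homA N) : homA M :=
  Submod (@homA_pred A M) (hom_pull_subproof f).

Fact hom_pull_linear : linear hom_pull_fun.
Proof. by move=> a f g; apply: val_inj; apply: funext=> u. Qed.

Definition hom_pull :
    {linear homA N -> homA M} := Linear hom_pull_linear.

Lemma hom_pullE f u : val (hom_pull f) u = val f (h u).
Proof. by []. Qed.

End Pull.

Section ExtMap.
Variables (M : lmodType A^c) (P Q : proj_resolution M).
Variable f : forall n, {linear res_mod P n -> res_mod Q n}.
Hypothesis fd : forall n x, res_diff Q n (f n.+1 x) = f n (res_diff P n x).

Lemma pull_cocycle n (g : homA (res_mod Q n)) :
  g \in @cocycle A M Q n -> hom_pull (f n) g \in @cocycle A M P n.
Proof.
by move=> /asboolP gc; apply/asboolP=> v; rewrite hom_pullE -fd gc.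
Qed.

Lemma pull_coboundary n (g : homA (res_mod Q n)) :
  g \in @coboundary A M Q n -> hom_pull (f n) g \in @coboundary A M P n.
Proof.
case: n g => [|n] g; first by move=> /eqP->; rewrite raddf0; exact: rpred0.
move=> /asboolP[h hE]; apply/asboolP; exists (hom_pull (f n) h) => v.
by rewrite !hom_pullE hE fd.
Qed.

Definition pull_cocycles n (g : submod (@cocycle A M Q n)) :
  submod (@cocycle A M P n) := Submod (@cocycle A M P n) (pull_cocycle (valP g)).

Fact pull_cocycles_linear n : linear (@pull_cocycles n).
Proof.
move=> a g h; apply: val_inj; rewrite [RHS]linearP.
rewrite -[LHS]/(hom_pull (f n) (val (a *: g + h))).
by rewrite [val _]linearP [LHS]linearP.
Qed.

Definition ext_class (R : proj_resolution M) n
    (g : submod (@cocycle A M R n)) : Ext R n := quot_pi _ g.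

Lemma ext_map_exists n : exists H : {linear Ext Q n -> Ext P n},
  forall g, H (ext_class g) = ext_class (pull_cocycles g).
Proof.
have [v|H HE] := quotmod_induced (W := @coboundary_in A M Q n)
    (W' := @coboundary_in A M P n) (h := Linear (@pull_cocycles_linear n)).
  by rewrite !unfold_in /= /coboundary_in => /pull_coboundary.
by exists H.
Qed.

End ExtMap.

Lemma ext_class_surj (M : lmodType A^c) (P : proj_resolution M) n (e : Ext P n) :
  exists g, e = ext_class g.
Proof. by exists (repr e); rewrite /ext_class quot_pi_repr. Qed.

Lemma ext_class_eq (M : lmodType A^c) (P : proj_resolution M) n
    (f g : submod (@cocycle A M P n)) :
  ext_class f = ext_class g <-> val f - val g \in @coboundary A M P n.
Proof. by rewrite /ext_class quot_piB -(raddfB val). Qed.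

(** The chain map [f - id] lifts zero, so it equals [d h + h d] for a homotopy [h]. A cocycle [g]
    kills [d h], which leaves [g h d], a coboundary; in degree 0 there is no [h d] term and the
    difference is zero. *)
Lemma homotopic_id_pull (M : lmodType A^c) (P : proj_resolution M)
    (f : forall n, {linear res_mod P n -> res_mod P n}) :
  (forall x, res_aug P (f 0%N x) = res_aug P x) ->
  (forall n x, res_diff P n (f n.+1 x) = f n (res_diff P n x)) ->
  forall n (g : homA (res_mod P n)), g \in @cocycle A M P n ->
  hom_pull (f n) g - g \in @coboundary A M P n.
Proof.
move=> f0 fd; have [|n x|h [h0 hE]] :=
    @chain_homotopy_exists _ _ P P (fun n => f n \- idfun).
- by move=> x /=; rewrite raddfB; apply/eqP; rewrite subr_eq0; apply/eqP/f0.
- by rewrite /= raddfB; congr (_ - _); apply: fd.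
case=> [|n] g /asboolP gc.
  apply/eqP/val_inj/funext=> v; rewrite -[RHS]/0 -[LHS]/(_ - _) hom_pullE.
  by have /= := h0 v => E; rewrite -homAN -homAD -E gc.
apply/asboolP; exists (hom_pull (h n) g) => v.
rewrite homA_valD homA_valN !hom_pullE -homAN -homAD.
have /(congr1 (val g)) := hE n v; rewrite gc /= homAD homAN => /esym/eqP.
by rewrite subr_eq0 => /eqP.
Qed.

Lemma Ext_unique (M : lmodType A^c) (P Q : proj_resolution M) n :
  isomorphic (Ext P n) (Ext Q n).
Proof.
have [f [f0 fd]] := chain_map_exists P Q.
have [g [g0 gd]] := chain_map_exists Q P.
have [F FE] := ext_map_exists gd n; have [G GE] := ext_map_exists fd n.
exists F; exists G => e; have [c ->] := ext_class_surj e.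
  rewrite FE GE ext_class_eq.
  have -> : val (pull_cocycles fd (pull_cocycles gd c)) =
      hom_pull (g n \o f n) (val c) by apply: val_inj.
  apply: (homotopic_id_pull (f := fun n => g n \o f n)); last exact: (valP c).
    by move=> x; rewrite /= g0 f0.
  by move=> m x; rewrite /= gd fd.
rewrite GE FE ext_class_eq.
have -> : val (pull_cocycles gd (pull_cocycles fd c)) =
    hom_pull (f n \o g n) (val c) by apply: val_inj.
apply: (homotopic_id_pull (f := fun n => f n \o g n)); last exact: (valP c).
  by move=> x; rewrite /= f0 g0.
by move=> m x; rewrite /= fd gd.
Qed.

End ExtIndependence.

(** * Modules over the incidence algebra *)

(** Over [A^c] and for the idempotent of [y], these are the nonzero quotients of the indecomposable
    projective at [y]. *)
Definition cyclic_at (B : pzRingType) (e : B) (M : lmodType B) : Prop :=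
  exists v : M, [/\ v != 0, e *: v = v & forall u, exists b : B, u = b *: v].

Lemma principal_submod_cyclic (B : pzRingType) (W : submodClosed B^o) (e : B) :
  e != 0 -> e * e = e -> (e : B^o) \in W ->
  (forall u : B^o, u \in W -> exists b : B, u = b * e) ->
  cyclic_at e (submod W).
Proof.
move=> e0 ee eW Wgen; exists (Submod W eW); split.
- by apply: contraNneq e0 => /(congr1 val)/= ->.
- by apply: val_inj; rewrite linearZ /= [LHS]ee.
move=> u; have [b ub] := Wgen _ (valP u); exists b.
by apply: val_inj; rewrite linearZ.
Qed.

Section IncidenceProducts.
Variables (K : fieldType) (d : Order.disp_t) (R : finPOrderType d).
Notation A := (incidence_alg K R).
Implicit Types (a b : A) (x y z : R).

Lemma inc_mulrE a b x z :
  val (a * b) (x, z) = \sum_y val a (x, y) * val b (y, z).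
Proof. exact: inc_mulE. Qed.

Lemma inc_1E x y : val (1 : A) (x, y) = (x == y)%:R.
Proof. exact: inc_oneE. Qed.

Lemma inc_idemE x y z : val (inc_idem K x) (y, z) = ((y == x) && (z == x))%:R.
Proof. by rewrite ffunE. Qed.

Lemma inc_idem_mulE a x y z :
  val ((inc_idem K x : A) * a) (y, z) = (y == x)%:R * val a (x, z).
Proof.
rewrite inc_mulrE (bigD1 x) //= big1 => [|u /negPf ux].
  by rewrite inc_idemE eqxx andbT addr0.
by rewrite inc_idemE ux andbF mul0r.
Qed.

Lemma inc_mul_idemE a x y z :
  val (a * (inc_idem K x : A)) (y, z) = val a (y, x) * (z == x)%:R.
Proof.
rewrite inc_mulrE (bigD1 x) //= big1 => [|u /negPf ux].
  by rewrite inc_idemE eqxx addr0.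
by rewrite inc_idemE ux mulr0.
Qed.

Lemma inc_mul_diag a b x :
  val (a * b) (x, x) = val a (x, x) * val b (x, x).
Proof.
rewrite inc_mulrE (bigD1 x) //= big1 ?addr0 // => y yx.
have [xy|nxy] := boolP (x <= y)%O; last by rewrite incidence_eq0 ?mul0r.
rewrite [X in _ * X]incidence_eq0 ?mulr0 //.
by apply: contra yx => yx; rewrite eq_le yx.
Qed.

Lemma inc_idem_sandwich a x :
  (inc_idem K x : A) * a * inc_idem K x = (val a (x, x) : K) *: inc_idem K x.
Proof.
apply: incidence_ext => y z.
rewrite inc_mul_idemE inc_idem_mulE inc_scaleE inc_idemE.
by case: eqP => _; case: eqP => _; rewrite ?(mul0r, mulr0, mul1r, mulr1).
Qed.

Lemma inc_idem_neq0 x : inc_idem K x != 0 :> A.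
Proof.
apply/eqP => /(congr1 (fun a : A => val a (x, x))) /eqP.
by rewrite inc_idemE eqxx ffunE oner_eq0.
Qed.

Lemma inc_idemK x : (inc_idem K x : A) * inc_idem K x = inc_idem K x.
Proof.
apply: incidence_ext => y z; rewrite inc_idem_mulE !inc_idemE eqxx.
by case: (y == x); rewrite ?mul1r ?mul0r.
Qed.

End IncidenceProducts.

(** * Local modules and their simple tops *)

Section LocalModules.
Variables (K : fieldType) (d : Order.disp_t) (R : finPOrderType d).
Notation A := (incidence_alg K R).

Definition kscale (M : lmodType A^c) (k : K) (v : M) : M :=
  ((k *: (1 : A) : A) : A^c) *: v.

Definition local_at (y : R) : lmodType A^c -> Prop :=
  cyclic_at (inc_idem K y : A^c).

(** Describes [S(y)] up to isomorphism: a line on which [a] acts through its diagonal coefficient at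
    [y]. *)
Definition simple_at (y : R) (M : lmodType A^c) : Prop :=
  exists t : M, [/\ t != 0,
    forall a : A, (a : A^c) *: t = kscale (val a (y, y)) t
    & forall u, exists k : K, u = kscale k t].

Lemma rscalerA (M : lmodType A^c) (a b : A) (v : M) :
  (b : A^c) *: ((a : A^c) *: v) = ((a * b : A) : A^c) *: v.
Proof. by rewrite scalerA. Qed.

Lemma kscaleDl (M : lmodType A^c) (k l : K) (v : M) :
  kscale (k + l) v = kscale k v + kscale l v.
Proof. by rewrite -scalerDl; congr (_ *: v); exact: (scalerDl (1 : A) k l). Qed.

Lemma rscaler_kscale (M : lmodType A^c) (k : K) (a : A) (v : M) :
  (a : A^c) *: kscale k v = ((k *: a : A) : A^c) *: v.
Proof. by rewrite rscalerA -inc_scalerAl mul1r. Qed.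

Lemma kscale_rscaler (M : lmodType A^c) (k : K) (a : A) (v : M) :
  kscale k ((a : A^c) *: v) = ((k *: a : A) : A^c) *: v.
Proof. by rewrite /kscale rscalerA -inc_scalerAr mulr1. Qed.

Lemma kscaleK (M : lmodType A^c) (k : K) (v : M) :
  k != 0 -> kscale k^-1 (kscale k v) = v.
Proof.
by move=> k0; rewrite {2}/kscale kscale_rscaler scalerA mulVf // !scale1r.
Qed.

Lemma kscale0 (M : lmodType A^c) (v : M) : kscale 0 v = 0.
Proof. by rewrite /kscale !scale0r. Qed.

Lemma kscale_inj (M : lmodType A^c) (t : M) (k l : K) : t != 0 ->
  kscale k t = kscale l t -> k = l.
Proof.
move=> t0 kl; apply/eqP; rewrite -subr_eq0; apply: contraNT t0 => kl0.
have kl_t : kscale (k - l) t = 0.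
  by apply: (addIr (kscale l t)); rewrite -kscaleDl subrK add0r.
by rewrite -(kscaleK t kl0) kl_t /kscale scaler0.
Qed.

Section Top.
Variables (y : R) (M : lmodType A^c) (v : M).
Hypothesis v0 : v != 0.
Hypothesis ve : (inc_idem K y : A^c) *: v = v.
Hypothesis vgen : forall u, exists a : A, u = (a : A^c) *: v.

(** Explicit candidate for the radical. It is a submodule because taking the diagonal coefficient at
    [y] is multiplicative ([inc_mul_diag]). *)
Definition local_rad : {pred M} := fun u =>
  `[< exists a : A, val a (y, y) = 0 /\ u = (a : A^c) *: v >].

Fact local_rad_submod_closed : submod_closed local_rad.
Proof.
split=> [|c u w /asboolP[a [a0 ->]] /asboolP[b [b0 ->]]]; apply/asboolP.
  by exists 0; rewrite scale0r ffunE.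
exists (a * c + b); rewrite inc_addE inc_mul_diag a0 b0 mul0r addr0; split=> //.
by rewrite rscalerA -scalerDl.
Qed.
HB.instance Definition _ :=
  GRing.isSubmodClosed.Build A^c M local_rad local_rad_submod_closed.

Lemma local_sandwich (a : A) :
  (inc_idem K y : A^c) *: ((a : A^c) *: v) = kscale (val a (y, y)) v.
Proof.
rewrite -[in LHS]ve !rscalerA mulrA inc_idem_sandwich -[in RHS]ve.
by rewrite kscale_rscaler.
Qed.

Lemma generator_notin_local_rad : v \notin local_rad.
Proof.
apply/negP => /asboolP[a [a0 va]]; case/negP: v0.
by rewrite -ve va local_sandwich a0 kscale0.
Qed.

(** An element [v . a] with nonzero diagonal coefficient generates everything: multiplying it by the
    idempotent of [y] gives a nonzero scalar multiple of [v], because the corner of [A] at [y] is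
    one-dimensional. Hence [local_rad] is the largest proper submodule. *)
Lemma proper_sub_local_rad (W : submodClosed M) :
  (exists u, u \notin W) -> {subset W <= local_rad}.
Proof.
move=> [u uW] w wW; apply/asboolP; have [a wa] := vgen w; exists a; split=> //.
apply/eqP; apply: contraNT uW => a0; have [b ->] := vgen u; apply: rpredZ.
have <- : kscale (val a (y, y))^-1 ((inc_idem K y : A^c) *: w) = v.
  by rewrite wa local_sandwich kscaleK.
by apply: rpredZ; apply: rpredZ.
Qed.

Lemma local_rad_maximal : maximal_submod local_rad.
Proof.
split=> [|W _]; first by exists v; exact: generator_notin_local_rad.
exact: proper_sub_local_rad.
Qed.

Lemma rad_local u : (u \in @rad A^c M) = (u \in local_rad).
Proof.
apply/idP/idP=> [/asboolP|uN]; first by apply; exact: local_rad_maximal.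
apply/asboolP=> W [Wproper Wmax].
apply: (Wmax local_rad); first exact: proper_sub_local_rad.
  by exists v; exact: generator_notin_local_rad.
exact: uN.
Qed.

End Top.

Lemma local_top_simple y (M : lmodType A^c) :
  local_at y M -> simple_at y (top M).
Proof.
move=> [v [v0 ve vgen]]; have radE := rad_local v0 ve vgen.
pose q : M -> top M := quot_pi (@rad A^c M).
have qZ (a : A) : (a : A^c) *: q v = kscale (val a (y, y)) (q v).
  rewrite /kscale -!quot_piZ; apply/quot_piB; rewrite radE -scalerBl.
  apply/asboolP.
  exists (a - ((val a (y, y) : K) *: (1 : A) : A)); split=> //.
  by rewrite !ffunE /= eqxx [_ *: _]mulr1 subrr.
exists (q v); split=> // [|u].
  apply/eqP => /quot_pi_eq0; rewrite radE.
  by apply/negP; exact: generator_notin_local_rad.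
rewrite -[u]quot_pi_repr; have [a ->] := vgen (repr u).
by exists (val a (y, y)); rewrite -qZ -quot_piZ.
Qed.

Lemma simple_at_iso y (M N : lmodType A^c) :
  simple_at y M -> simple_at y N -> isomorphic M N.
Proof.
move=> [s [s0 sa sgen]] [t [t0 ta tgen]].
pose k u := sval (cid (sgen u)); pose l u := sval (cid (tgen u)).
have kE u : u = kscale (k u) s by rewrite /k; case: cid.
have lE u : u = kscale (l u) t by rewrite /l; case: cid.
have scaleE (c : K) (a : A) (M' : lmodType A^c) (r : M') :
    (forall b : A, (b : A^c) *: r = kscale (val b (y, y)) r) ->
    (a : A^c) *: kscale c r = kscale (c * val a (y, y)) r.
  by move=> rE; rewrite rscaler_kscale rE inc_scaleE.
have fL : linear (fun u => kscale (k u) t).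
  move=> a u w; rewrite scaleE // -kscaleDl; congr kscale.
  by apply: (kscale_inj s0); rewrite kscaleDl -scaleE // -!kE.
exists (Linear fL); exists (fun u => kscale (l u) s) => u /=.
  rewrite [RHS]kE; congr kscale.
  by apply: (kscale_inj t0); rewrite -lE.
rewrite [RHS]lE; congr kscale.
by apply: (kscale_inj s0); rewrite -kE.
Qed.

End LocalModules.

(** * Reduction of the grade bijection to one chosen resolution *)

Section GradeReduction.
Variables (K : fieldType) (d : Order.disp_t) (R : finPOrderType d).
Notation A := (incidence_alg K R).

Lemma indec_proj_local (x : R) : local_at x (indec_proj K x).
Proof.
apply: (@principal_submod_cyclic A^c (@proj_pred K d R x) (inc_idem K x)).
- exact: inc_idem_neq0.
- exact: inc_idemK.
- by apply/asboolP; exists 1; rewrite mulr1.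
by move=> u /asboolP.
Qed.

Lemma simple_mod_simple_at (x : R) : simple_at x (simple_mod K x).
Proof. exact/local_top_simple/indec_proj_local. Qed.

Lemma dual_linear (E : lmodType A) (phi : dual E) (k : K) (u v : E) :
  val phi ((k *: (1 : A)) *: u + v) = k * val phi u + val phi v.
Proof. by have /asboolP := valP phi; apply. Qed.

Lemma dualD (E : lmodType A) (phi : dual E) (u v : E) :
  val phi (u + v) = val phi u + val phi v.
Proof. by have := dual_linear phi 1 u v; rewrite !scale1r mul1r. Qed.

Lemma dual0 (E : lmodType A) (phi : dual E) : val phi 0 = 0.
Proof. by apply: (addrI (val phi 0)); rewrite -dualD !addr0. Qed.

Lemma dual_rscalerE (E : lmodType A) (phi : dual E) (a : A) (u : E) :
  val ((a : A^c) *: phi) u = val phi (a *: u).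
Proof. by []. Qed.

Section DualPull.
Variables (E F : lmodType A) (f : {linear E -> F}).

Fact dual_pull_subproof (phi : dual F) : val phi \o f \in @dual_pred K d R E.
Proof. by apply/asboolP=> k u v; rewrite /= linearP dual_linear. Qed.

Definition dual_pull (phi : dual F) : dual E :=
  @exist _ (fun phi => phi \in @dual_pred K d R E) _ (dual_pull_subproof phi).

Lemma dual_pullZ (a : A) (phi : dual F) :
  dual_pull ((a : A^c) *: phi) = (a : A^c) *: dual_pull phi.
Proof.
apply: val_inj; apply: funext => u.
by rewrite dual_rscalerE /= linearZ.
Qed.

End DualPull.

Lemma local_at_dual_iso (y : R) (E F : lmodType A) :
  isomorphic E F -> local_at y (dual F) -> local_at y (dual E).
Proof.
move=> [f [g fK gK]] [v [v0 ve vgen]].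
have gL : linear g by move=> a u w; rewrite -{1}[u]gK -{1}[w]gK -linearP fK.
pose G := Linear gL.
have pullK phi : dual_pull f (dual_pull G phi) = phi.
  by apply: val_inj; apply: funext => u; rewrite /= fK.
have pullK' phi : dual_pull G (dual_pull f phi) = phi.
  by apply: val_inj; apply: funext => u; rewrite /= gK.
exists (dual_pull f v); split; last 1 first.
- move=> u; have [a ua] := vgen (dual_pull G u); exists a.
  by rewrite -[u]pullK ua dual_pullZ.
- apply: contraNneq v0 => fv0; rewrite -[v]pullK' fv0.
  by apply/eqP/val_inj.
by rewrite -dual_pullZ ve.
Qed.

Lemma local_dual_neq0 (y : R) (E : lmodType A) :
  local_at y (dual E) -> exists e : E, e != 0.
Proof.
move=> [v [v0 _ _]]; apply: contrapT => E0; case/eqP: v0.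
apply: val_inj; apply: funext => u.
have [->|u0] := eqVneq u 0; first exact: dual0.
by case: E0; exists u.
Qed.

(** [grade_image] speaks of every resolution, but [Ext_unique] carries both the vanishing below [g]
    and the local dual in degree [g] over from [Q] to any other one. *)
Lemma grade_image_of_resolution (x y : R)
    (Q : proj_resolution (simple_mod K x)) (g : nat) :
  (forall i, (i < g)%N -> forall e : Ext Q i, e = 0) ->
  local_at y (dual (Ext Q g)) -> grade_image K x y.
Proof.
move=> Q0 Qg; split=> [|P]; first exact: (inhabits Q).
have Pg := local_at_dual_iso (Ext_unique P Q g) Qg.
exists g; split; last first.
  exact: (simple_at_iso (local_top_simple Pg) (simple_mod_simple_at y)).
split=> [|i ig e]; first exact: local_dual_neq0 Pg.
have [f /bij_inj f_inj] := Ext_unique P Q i.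
by apply: f_inj; rewrite [RHS]raddf0; exact: Q0.
Qed.

End GradeReduction.

(** * Finite sums of indecomposable projectives in coordinates *)

Section RowModules.
Variables (K : fieldType) (d : Order.disp_t) (R : finPOrderType d).
Notation A := (incidence_alg K R).
Variable T : finType.

(** Copies, indexed by [T], of the space of row vectors over [R], on which [A] acts by matrix
    multiplication from the right. The projectives are cut out of it by support conditions. *)
Definition rowmod := {ffun T * R -> K}.
HB.instance Definition _ := GRing.Zmodule.on rowmod.

Definition rowmod_scale (a : A^c) (v : rowmod) : rowmod :=
  [ffun p => \sum_u v (p.1, u) * (val (a : A) (u, p.2) : K)].

Fact rowmod_scaleA a b v :
  rowmod_scale a (rowmod_scale b v) = rowmod_scale (a * b) v.
Proof.
apply/ffunP=> -[t w]; rewrite !ffunE /=.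
under eq_bigr do rewrite ffunE mulr_suml.
rewrite exchange_big; apply: eq_bigr => u _ /=.
rewrite [X in _ = _ * X](inc_mulrE (b : A) (a : A)) mulr_sumr.
by apply: eq_bigr => x _; rewrite mulrA.
Qed.

Fact rowmod_scale1 : left_id 1 rowmod_scale.
Proof.
move=> v; apply/ffunP=> -[t w]; rewrite ffunE (bigD1 w) //= big1 => [|u uw].
  by rewrite ffunE /= eqxx mulr1 addr0.
by rewrite ffunE /= (negPf uw) mulr0.
Qed.

Fact rowmod_scaleDr : right_distributive rowmod_scale +%R.
Proof.
move=> a u v; apply/ffunP=> -[t w]; rewrite !ffunE -big_split.
by apply: eq_bigr => x _; rewrite ffunE mulrDl.
Qed.

Fact rowmod_scaleDl v : {morph rowmod_scale^~ v : a b / a + b}.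
Proof.
move=> a b; apply/ffunP=> -[t w]; rewrite !ffunE -big_split.
by apply: eq_bigr => x _; rewrite inc_addE mulrDr.
Qed.

HB.instance Definition _ := GRing.Zmodule_isLmodule.Build A^c rowmod
  rowmod_scaleA rowmod_scale1 rowmod_scaleDr rowmod_scaleDl.

Lemma rowmod_scaleE (a : A) (v : rowmod) t w :
  ((a : A^c) *: v) (t, w) = \sum_u v (t, u) * (val a (u, w) : K).
Proof. exact: ffunE. Qed.

Variables (D : pred T) (b : T -> R).

(* A model of the direct sum of the e_(b t) A over the t satisfying D: v (t, w)
   is the coefficient of p_(b t, w) in the component t. *)
Definition proj_sum_pred : {pred rowmod} := fun v =>
  [forall t, forall w, ~~ (D t && (b t <= w)%O) ==> (v (t, w) == 0)].

Lemma proj_sum_predP (v : rowmod) :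
  reflect (forall t w, ~~ (D t && (b t <= w)%O) -> v (t, w) = 0)
    (v \in proj_sum_pred).
Proof.
apply: (iffP forallP) => [h t w n | h t].
  by move/forallP: (h t) => /(_ w); rewrite n => /eqP.
by apply/forallP=> w; apply/implyP=> n; apply/eqP/h.
Qed.

Fact proj_sum_submod_closed : submod_closed proj_sum_pred.
Proof.
split=> [|a u v /proj_sum_predP hu /proj_sum_predP hv];
  apply/proj_sum_predP => t w n; rewrite !ffunE //= hv // addr0 big1 // => x _.
have [xw|nxw] := boolP (x <= w)%O; last by rewrite incidence_eq0 ?mulr0.
rewrite hu ?mul0r //; apply: contra n => /andP[-> tx].
exact: le_trans xw.
Qed.
HB.instance Definition _ := GRing.isSubmodClosed.Build A^c rowmod proj_sum_pred
  proj_sum_submod_closed.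

Definition proj_sum : lmodType A^c := submod proj_sum_pred.

Definition coord (v : proj_sum) (t : T) (w : R) : K := (val v : rowmod) (t, w).

Lemma coord_ext (u v : proj_sum) :
  (forall t w, coord u t w = coord v t w) -> u = v.
Proof. by move=> uv; apply: val_inj; apply/ffunP => -[t w]; exact: uv. Qed.

Lemma coordD (u v : proj_sum) t w : coord (u + v) t w = coord u t w + coord v t w.
Proof. by rewrite /coord raddfD ffunE. Qed.

Lemma coord0 t w : coord 0 t w = 0.
Proof. by rewrite /coord raddf0 ffunE. Qed.

Lemma coordZ (a : A) (v : proj_sum) t w :
  coord ((a : A^c) *: v) t w = \sum_u coord v t u * (val a (u, w) : K).
Proof. by rewrite /coord linearZ rowmod_scaleE. Qed.

Lemma coord_sum I r (P : pred I) (F : I -> proj_sum) t w :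
  coord (\sum_(i <- r | P i) F i) t w = \sum_(i <- r | P i) coord (F i) t w.
Proof.
elim/big_rec2: _ => [|i x y _ <-]; first exact: coord0.
exact: coordD.
Qed.

Lemma coord_eq0 (v : proj_sum) t w : ~~ (D t && (b t <= w)%O) -> coord v t w = 0.
Proof. by have /proj_sum_predP := valP v; apply. Qed.

Definition of_coord_fun (c : T -> R -> K) : rowmod :=
  [ffun p => if D p.1 && (b p.1 <= p.2)%O then c p.1 p.2 else 0].

Fact of_coord_subproof c : of_coord_fun c \in proj_sum_pred.
Proof. by apply/proj_sum_predP => t w n; rewrite ffunE /= (negPf n). Qed.

Definition of_coord (c : T -> R -> K) : proj_sum :=
  Submod proj_sum_pred (of_coord_subproof c).

Lemma of_coordE c t w :
  coord (of_coord c) t w = if D t && (b t <= w)%O then c t w else 0.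
Proof. by rewrite /coord ffunE. Qed.

Definition gen (t : T) : proj_sum :=
  of_coord (fun t' w => ((t' == t) && (w == b t))%:R).

Lemma coord_gen t t' w :
  coord (gen t) t' w = [&& D t, t' == t & w == b t]%:R.
Proof.
rewrite of_coordE; have [->|] := eqVneq t' t; last by case: ifP; rewrite andbF.
case: (D t) => //=; have [->|] := eqVneq w (b t); first by rewrite lexx.
by case: ifP.
Qed.

Definition row_fun (v : proj_sum) (t : T) : {ffun R * R -> K^o} :=
  [ffun p => (p.1 == b t)%:R * coord v t p.2].

Fact row_subproof v t : row_fun v t \in @incidence_pred K d R.
Proof.
apply/incidence_predP=> x y nxy; rewrite ffunE /=.
have [xt|] := eqVneq x (b t); last by rewrite mul0r.
by rewrite coord_eq0 ?mulr0 // -xt (negPf nxy) andbF.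
Qed.

Definition row (v : proj_sum) (t : T) : A :=
  @exist _ (fun f => f \in @incidence_pred K d R) _ (row_subproof v t).

Lemma rowE v t x y : val (row v t) (x, y) = (x == b t)%:R * coord v t y.
Proof. by rewrite ffunE. Qed.

Lemma row_linear t (a : A) (u v : proj_sum) :
  row ((a : A^c) *: u + v) t = row u t * a + row v t.
Proof.
apply: incidence_ext => x y; rewrite inc_addE inc_mulrE !rowE coordD coordZ.
rewrite mulrDr mulr_sumr; congr (_ + _); apply: eq_bigr => z _.
by rewrite rowE mulrA.
Qed.

Lemma proj_sum_decomp (v : proj_sum) :
  v = \sum_t ((row v t : A) : A^c) *: gen t.
Proof.
apply: coord_ext => t w; rewrite coord_sum (bigD1 t) //= big1 => [|t' t't].
  rewrite addr0 coordZ (bigD1 (b t)) //= big1 => [|u ub].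
    rewrite coord_gen !eqxx !andbT addr0 rowE eqxx mul1r.
    by case Dt: (D t); rewrite ?mul1r // mul0r coord_eq0 ?Dt.
  by rewrite coord_gen (negPf ub) !andbF mul0r.
rewrite coordZ big1 // => u _.
by rewrite coord_gen eq_sym (negPf t't) andbF mul0r.
Qed.

(** Lift each generator arbitrarily and extend by the coefficients [row v t]. The lift [u t] need
    not be fixed by the idempotent of [b t]: after applying [p], [proj_sum_decomp] still gives back
    [f v]. *)
Lemma proj_sum_projective : projective proj_sum.
Proof.
move=> U V p f p_surj.
have /choice[u uE] t : exists u, p u = f (gen t) by exact: p_surj.
have gL : linear (fun v : proj_sum => \sum_t ((row v t : A) : A^c) *: u t).
  move=> a v w; rewrite scaler_sumr -big_split; apply: eq_bigr => t _ /=.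
  by rewrite row_linear scalerA -scalerDl.
exists (Linear gL) => v /=; rewrite [in RHS](proj_sum_decomp v) !linear_sum.
by apply: eq_bigr => t _; rewrite !linearZ uE.
Qed.

(** A map from the projective at [b t] to [A] is determined by the image of the generator, which is
    a column of [A]; its entry in row [z] is the component of the left module [homA] at [z]. *)
Definition hom_coord (f : homA proj_sum) (z : R) (t : T) : K :=
  val (val f (gen t) : A) (z, b t).

Lemma homA_sum (M : lmodType A^c) (f : homA M) I r (P : pred I) (F : I -> M) :
  val f (\sum_(i <- r | P i) F i) = \sum_(i <- r | P i) val f (F i).
Proof.
elim/big_rec2: _ => [|i x y _ <-]; first exact: homA0.
exact: homAD.
Qed.

Lemma hom_coordE (f : homA proj_sum) (v : proj_sum) z w :
  val (val f v : A) (z, w) = \sum_t hom_coord f z t * coord v t w.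
Proof.
rewrite [in LHS](proj_sum_decomp v) homA_sum.
rewrite [val _](raddf_sum val) sum_ffunE; apply: eq_bigr => t _.
rewrite homAZ inc_mulrE (bigD1 (b t)) //= big1 => [|u ub].
  by rewrite addr0 rowE eqxx mul1r.
by rewrite rowE (negPf ub) mul0r mulr0.
Qed.

Lemma hom_coord_ext (f g : homA proj_sum) :
  (forall z t, hom_coord f z t = hom_coord g z t) -> f = g.
Proof.
move=> fg; apply: val_inj; apply: funext => v; apply: (@incidence_ext K d R) => z w.
by rewrite !hom_coordE; apply: eq_bigr => t _; rewrite fg.
Qed.

Lemma gen_eq0 t : ~~ D t -> gen t = 0.
Proof.
by move=> /negPf Dt; apply: coord_ext => t' w; rewrite coord_gen Dt coord0.
Qed.

Lemma hom_coord_eq0 (f : homA proj_sum) z t :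
  ~~ (D t && (z <= b t)%O) -> hom_coord f z t = 0.
Proof.
rewrite negb_and => /orP[Dt|nzt]; last by rewrite /hom_coord incidence_eq0.
by rewrite /hom_coord gen_eq0 // homA0 ffunE.
Qed.

Section OfHomCoord.
Variable c : R -> T -> K.
Hypothesis c_supp : forall z t, ~~ (z <= b t)%O -> c z t = 0.

Definition of_hom_coord_fun2 (v : proj_sum) : {ffun R * R -> K^o} :=
  [ffun p => \sum_t c p.1 t * coord v t p.2].

Fact of_hom_coord_subproof v : of_hom_coord_fun2 v \in @incidence_pred K d R.
Proof.
apply/incidence_predP=> z w nzw; rewrite ffunE big1 //= => t _.
have [zt|nzt] := boolP (z <= b t)%O; last by rewrite c_supp ?mul0r.
rewrite coord_eq0 ?mulr0 //; apply: contra nzw => /andP[_].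
exact: le_trans.
Qed.

Definition of_hom_coord_fun (v : proj_sum) : A^o :=
  @exist _ (fun f => f \in @incidence_pred K d R) _ (of_hom_coord_subproof v).

Lemma of_hom_coord_funE v z w :
  val (of_hom_coord_fun v : A) (z, w) = \sum_t c z t * coord v t w.
Proof. by rewrite ffunE. Qed.

Fact of_hom_coord_homA : of_hom_coord_fun \in @homA_pred A proj_sum.
Proof.
apply/asboolP=> a u v; apply: (@incidence_ext K d R) => z w.
rewrite of_hom_coord_funE inc_addE inc_mulrE of_hom_coord_funE.
under [in RHS]eq_bigr do rewrite of_hom_coord_funE mulr_suml.
rewrite exchange_big -big_split; apply: eq_bigr => t _ /=.
rewrite coordD coordZ mulrDr mulr_sumr; congr (_ + _).
by apply: eq_bigr => x _; rewrite mulrA.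
Qed.

Definition of_hom_coord : homA proj_sum :=
  Submod (@homA_pred A proj_sum) of_hom_coord_homA.

Lemma of_hom_coordE z t : D t -> hom_coord of_hom_coord z t = c z t.
Proof.
move=> Dt; rewrite [LHS]of_hom_coord_funE (bigD1 t) //= big1 => [|t' t't].
  by rewrite coord_gen Dt !eqxx mulr1 addr0.
by rewrite coord_gen (negPf t't) andbF mulr0.
Qed.

End OfHomCoord.

End RowModules.

(** * Koszul resolutions of simple modules *)

(** The order given by [enum_rank] pairs [(j, k)] with [(k, j)]. Merely swapping the two sums would
    only show that twice the sum vanishes, which is useless in characteristic 2. *)
Lemma big_antisym (V : zmodType) (T : finType) (P : pred T) (a : T -> T -> V) :
  (forall j k, P j -> P k -> j != k -> a k j = - a j k) ->
  \sum_(j | P j) \sum_(k | P k && (k != j)) a j k = 0.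
Proof.
move=> aN; pose lt (j k : T) := (enum_rank j < enum_rank k)%N.
have ltE j k : j != k -> lt k j = ~~ lt j k.
  rewrite /lt => jk; case: ltngtP => // /ord_inj/enum_rank_inj kj.
  by rewrite kj eqxx in jk.
under eq_bigr => j _ do rewrite (bigID (lt j)) /=.
rewrite big_split /= [X in _ + X](exchange_big_dep P) /=; last first.
  by move=> j k _ /andP[/andP[]].
rewrite -big_split big1 //= => j Pj; apply/eqP; rewrite addr_eq0 -sumrN; apply/eqP.
apply: eq_big => [k|k /andP[/andP[Pk kj] _]].
  case Pk: (P k) => //=; rewrite Pj /= eq_sym; case: eqVneq => //= jk.
  by rewrite ltE // eq_sym. 
by apply: aN.
Qed.

Section Koszul.
Variables (K : comPzRingType) (T : finType) (S : {set T}).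
Implicit Types (I : {set T}) (i j k p : T) (c : {set T} -> K).

Definition ksign j I : K :=
  (-1) ^+ #|[set i in I | (enum_rank i < enum_rank j)%N]|.

Lemma ksignK j I : ksign j I * ksign j I = 1.
Proof. by rewrite -expr2 sqrr_sign. Qed.

Lemma ksignU j k I : k \notin I ->
  ksign j (k |: I) = (-1) ^+ (enum_rank k < enum_rank j)%N * ksign j I.
Proof.
move=> kI; rewrite /ksign; case kj: (enum_rank k < enum_rank j)%N.
  rewrite -exprD; congr (_ ^+ _).
  have -> : [set i in k |: I | (enum_rank i < enum_rank j)%N] =
      k |: [set i in I | (enum_rank i < enum_rank j)%N].
    by apply/setP=> i; rewrite !inE andb_orl; case: eqP => // ->; rewrite kj.
  by rewrite cardsU1 inE (negPf kI).
rewrite mul1r; congr (_ ^+ _); apply: eq_card => i.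
by rewrite !inE andb_orl; case: eqP => // ->; rewrite kj andbF.
Qed.

Lemma ksign_swap j k I : j != k -> j \notin I -> k \notin I ->
  ksign j (k |: I) * ksign k (j |: I) = - (ksign j I * ksign k I).
Proof.
move=> jk jI kI; rewrite !ksignU // mulrACA -[RHS]mulN1r; congr (_ * _).
case: (ltngtP (enum_rank k) (enum_rank j)) => [_|_|/ord_inj/enum_rank_inj kj].
- by rewrite expr1 mulr1.
- by rewrite expr1 mul1r.
by rewrite kj eqxx in jk.
Qed.

Lemma ksign_anticomm j k I : j != k -> j \notin I -> k \notin I ->
  ksign k I * ksign j (k |: I) = - (ksign j I * ksign k (j |: I)).
Proof.
move=> jk jI kI; rewrite !ksignU //.
case: (ltngtP (enum_rank k) (enum_rank j)) => [_|_|/ord_inj/enum_rank_inj kj].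
- by rewrite expr1 mul1r mulN1r mulrN mulrC.
- by rewrite expr1 mul1r mulN1r mulrN opprK mulrC.
by rewrite kj eqxx in jk.
Qed.

(** The simplicial boundary on subsets of [S], written on coefficients: the value at [I] collects
    the faces of all sets [j |: I]. [kcobd] is its transpose ([kbd_adjoint]). *)
Definition kbd c I : K := \sum_(j in S :\: I) ksign j I * c (j |: I).

Definition kcobd c I : K := \sum_(j in I) ksign j (I :\ j) * c (I :\ j).

Lemma kbd_kbd c I : kbd (kbd c) I = 0.
Proof.
rewrite /kbd; under eq_bigr => j _ do rewrite mulr_sumr.
rewrite -[RHS](@big_antisym _ _ [in S :\: I]
  (fun j k => ksign j I * (ksign k (j |: I) * c (k |: (j |: I))))) /=.
  apply: eq_bigr => j jI; apply: eq_bigl => k.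
  by rewrite !inE negb_or; case: eqP; rewrite ?andbF ?andbT.
move=> j k /setDP[_ jI] /setDP[_ kI] jk; rewrite !mulrA setUCA -mulNr.
by rewrite ksign_anticomm.
Qed.

Definition khomotopy p c I : K :=
  if p \in I then ksign p (I :\ p) * c (I :\ p) else 0.

(** Coning off the vertex [p] contracts the full simplex. The terms with [j = p] contribute [c I],
    and the remaining ones cancel in pairs by [ksign_swap]. *)
Lemma kbd_homotopy p c I : p \in S ->
  kbd (khomotopy p c) I + khomotopy p (kbd c) I = c I.
Proof.
move=> pS; rewrite /khomotopy; case: ifPn => [pI|pI].
  set I' := I :\ p; have pI' : p \notin I' by rewrite !inE eqxx.
  have IE : I = p |: I' by rewrite setD1K.
  rewrite {2}/kbd (bigD1 p) /=; last by rewrite inE pI'.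
  rewrite mulrDr mulrA ksignK mul1r -IE addrCA -[RHS]addr0; congr (_ + _).
  rewrite mulr_sumr /kbd.
  have SI j : (j \in S :\: I') && (j != p) = (j \in S :\: I).
    by rewrite !inE negb_and negbK; case: eqP => [->|]; rewrite ?pI ?andbF ?andbT.
  rewrite [X in _ + X](eq_bigl _ _ SI).
  rewrite -big_split big1 //= => j /setDP[jS jI].
  have jp : j != p by apply: contraNneq jI => ->.
  have jI' : j \notin I' by rewrite !inE negb_and jI orbT.
  have -> : (j |: I) :\ p = j |: I'.
    apply/setP=> i; rewrite !inE andb_orr.
    by case: (eqVneq i j) => [->|_]; rewrite ?jp ?andbF.
  rewrite !inE pI orbT !mulrA -mulrDl {1}IE (ksign_swap jp jI' pI').
  by rewrite (mulrC (ksign p _)) addNr mul0r.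
rewrite addr0 /kbd (bigD1 p) /=; last by rewrite inE pI.
rewrite setU11 setU1K // mulrA ksignK mul1r big1 ?addr0 // => j /andP[_ jp].
by rewrite !inE (negPf pI) eq_sym (negPf jp) mulr0.
Qed.

Definition kcohomotopy p c I : K :=
  if p \in I then 0 else ksign p I * c (p |: I).

Lemma kcobd_homotopy p c I :
  kcobd (kcohomotopy p c) I + kcohomotopy p (kcobd c) I = c I.
Proof.
rewrite /kcohomotopy; case: ifPn => [pI|pI].
  rewrite addr0 /kcobd (bigD1 p) //= !inE eqxx /= setD1K // mulrA ksignK mul1r.
  rewrite big1 ?addr0 // => j /andP[_ jp].
  by rewrite !inE pI eq_sym jp mulr0.
rewrite [X in _ + _ * X]/kcobd big_setU1 //= setU1K // mulrDr mulrA ksignK mul1r.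
rewrite addrCA -[RHS]addr0; congr (_ + _); rewrite mulr_sumr /kcobd.
rewrite -big_split big1 //= => j jI; set I' := I :\ j.
have jI' : j \notin I' by rewrite !inE eqxx.
have pI' : p \notin I' by rewrite !inE negb_and pI orbT.
have jp : j != p by apply: contraNneq pI => <-.
have -> : (p |: I) :\ j = p |: I'.
  apply/setP=> i; rewrite !inE andb_orr.
  by case: (eqVneq i p) => [->|_]; rewrite ?(eq_sym p) ?jp ?andbF.
rewrite (negPf pI') !mulrA -mulrDl -[in ksign p I](setD1K jI) -/I'.
by rewrite (mulrC (ksign p (j |: _))) (ksign_swap jp jI' pI') addrN mul0r.
Qed.

End Koszul.

Section KoszulResolution.
Variables (K : fieldType) (d : Order.disp_t) (R : finTBLatticeType d).
Notation A := (incidence_alg K R).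
Variables (x : R) (S : {set R}).
Hypothesis S_nle : forall p, p \in S -> ~~ (p <= x)%O.
Hypothesis S_lt : forall w, (x < w)%O -> exists2 p, p \in S & (p <= w)%O.

Implicit Types (I J : {set R}) (p : R).

Definition xjoin (I : {set R}) : R := (x `|` \join_(i in I) i)%O.

Lemma xjoin_le I w : (xjoin I <= w)%O = (x <= w)%O && [forall i in I, (i <= w)%O].
Proof.
rewrite leUx; congr (_ && _); apply/joinsP/forall_inP => h i; first exact: h.
by move=> iI; exact: h.
Qed.

Lemma xjoinU p I w : (xjoin (p |: I) <= w)%O = (p <= w)%O && (xjoin I <= w)%O.
Proof.
rewrite !xjoin_le.
apply/andP/andP => [[xw /forall_inP h]|[pw /andP[xw /forall_inP h]]].
  split; first by apply: h; rewrite setU11.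
  by rewrite xw; apply/forall_inP => i iI; apply: h; rewrite setU1r.
by split=> //; apply/forall_inP=> i; rewrite !inE => /orP[/eqP->|/h].
Qed.

Lemma xjoin0 : xjoin set0 = x.
Proof. by rewrite /xjoin big_set0 joinx0. Qed.

Lemma xjoin_ge I : (x <= xjoin I)%O.
Proof. exact: leUl. Qed.

(** The index type is [{set R}] in every degree and the degree is a support condition, so [kbd] and
    [khomotopy] act on all coefficient functions directly. *)
Definition kdeg n (I : {set R}) := (I \subset S) && (#|I| == n).

Definition kmod n : lmodType A^c := proj_sum K (kdeg n) xjoin.

Definition kdiff_fun n (v : kmod n.+1) : kmod n :=
  of_coord (K := K) (kdeg n) xjoin (fun I w => kbd S (fun J => coord v J w) I).

Lemma kdegU n p I : p \notin I -> kdeg n.+1 (p |: I) = (p \in S) && kdeg n I.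
Proof.
by move=> pI; rewrite /kdeg cardsU1 pI add1n eqSS subUset sub1set andbA.
Qed.

Lemma kdiffE n (v : kmod n.+1) I w :
  coord (kdiff_fun v) I w = kbd S (fun J => coord v J w) I.
Proof.
rewrite of_coordE; case: ifPn => // nI; rewrite /kbd big1 // => j /setDP[jS jI].
rewrite coord_eq0 ?mulr0 // kdegU // jS xjoinU /=.
by apply: contra nI => /andP[-> /andP[_ ->]].
Qed.

Fact kdiff_linear n : linear (@kdiff_fun n).
Proof.
move=> a u v; apply: coord_ext => I w; rewrite coordD coordZ !kdiffE.
under [X in _ = X + _]eq_bigr do rewrite kdiffE /kbd mulr_suml.
rewrite exchange_big -big_split; apply: eq_bigr => j _ /=.
rewrite coordD coordZ mulrDr mulr_sumr; congr (_ + _).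
by apply: eq_bigr => z _; rewrite mulrA.
Qed.

Definition kdiff n : {linear kmod n.+1 -> kmod n} := Linear (@kdiff_linear n).

Definition kpick (w : R) : option R := [pick p in S | (p <= w)%O].

(** At each [w] the cone point is an element of [S] below [w]. This choice varies with [w], so the
    map need not be linear over [A]; it only serves to exhibit preimages. *)
Definition khom_fun n (v : kmod n) : kmod n.+1 :=
  of_coord (K := K) (kdeg n.+1) xjoin (fun I w =>
    if kpick w is Some p then khomotopy p (fun J => coord v J w) I else 0).

Lemma khomE n (v : kmod n) I w p : kpick w = Some p ->
  coord (khom_fun v) I w = khomotopy p (fun J => coord v J w) I.
Proof.
move=> wp; rewrite of_coordE wp; case: ifPn => // nI; rewrite /khomotopy.
move: wp; rewrite /kpick; case: pickP => // q /andP[qS qw] [qp]; subst q.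
case: ifP => // pI; rewrite coord_eq0 ?mulr0 //; apply: contra nI => /andP[D J].
rewrite -{1 2}(setD1K pI) kdegU ?xjoinU ?qS ?D ?qw ?J //.
by rewrite !inE eqxx.
Qed.

Lemma kpick_gt w : (x < w)%O -> exists2 p, p \in S & kpick w = Some p.
Proof.
move=> /S_lt[q qS qw]; rewrite /kpick; case: pickP => [p /andP[pS _]|/(_ q)].
  by exists p.
by rewrite qS qw.
Qed.

(** At a fixed [w] above [x], the indices with [xjoin x I <= w] are the subsets of the set of [p] in
    [S] below [w]. They form a full simplex, contracted by [khomotopy] as soon as it has a
    vertex. *)
Lemma kmod_exact n (v : kmod n.+1) :
  kdiff n v = 0 <-> exists u, kdiff n.+1 u = v.
Proof.
split=> [dv|[u <-]]; last first.
  apply: coord_ext => I w.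
  rewrite coord0 kdiffE -[RHS](kbd_kbd S (fun J => coord u J w) I).
  by apply: eq_bigr => j _; rewrite kdiffE.
exists (khom_fun v); apply: coord_ext => I w; rewrite kdiffE.
have [/andP[D Iw]|nI] := boolP (kdeg n.+1 I && (xjoin I <= w)%O); last first.
  by rewrite -kdiffE !coord_eq0.
(* In positive degree [I] has an element; it lies below [w] but not below [x], so [w] is strictly
   above [x] and a cone point exists. *)
have [p pS wp] : exists2 p, p \in S & kpick w = Some p.
  apply: kpick_gt; rewrite lt_def (le_trans (xjoin_ge I) Iw) andbT.
  move: D => /andP[/subsetP IS /eqP I1].
  have /card_gt0P[i iI] : (0 < #|I|)%N by rewrite I1.
  apply: contraNneq (S_nle (IS i iI)) => <-.
  by move: Iw; rewrite xjoin_le => /andP[_ /forall_inP]; apply.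
rewrite -[RHS](kbd_homotopy (fun J => coord v J w) I pS).
rewrite [X in _ = _ + X](_ : _ = 0) ?addr0.
  by apply: eq_bigr => j _; rewrite (khomE _ _ wp).
rewrite /khomotopy; case: ifP => // _.
by rewrite -kdiffE [kdiff_fun v]dv coord0 mulr0.
Qed.

Section Augmentation.
Variables (M : lmodType A^c) (t : M).
Hypothesis t0 : t != 0.
Hypothesis tZ : forall a : A, (a : A^c) *: t = kscale (val a (x, x) : K) t.
Hypothesis t_gen : forall u, exists k : K, u = kscale k t.

Definition kaug_fun (v : kmod 0) : M := kscale (coord v set0 x) t.

Lemma coord_kmod0_x (v : kmod 0) w :
  coord v set0 w != 0 -> (x <= w)%O.
Proof.
apply: contraNT => xw; apply/eqP/coord_eq0.
by rewrite xjoin0 (negPf xw) andbF.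
Qed.

Fact kaug_linear : linear kaug_fun.
Proof.
move=> a u v; rewrite /kaug_fun rscaler_kscale tZ -kscaleDl; congr kscale.
rewrite coordD coordZ inc_scaleE; congr (_ + _).
rewrite (bigD1 x) //= big1 ?addr0 // => z zx.
have [->|/coord_kmod0_x xz] := eqVneq (coord u set0 z) 0; first by rewrite mul0r.
rewrite incidence_eq0 ?mulr0 //; apply: contra zx => zx.
by rewrite eq_le zx.
Qed.

Definition kaug : {linear kmod 0 -> M} := Linear kaug_linear.

Lemma kaug_surj m : exists v, kaug v = m.
Proof.
have [k ->] := t_gen m.
exists (of_coord (K := K) (kdeg 0) xjoin (fun I w => k)).
by rewrite /= /kaug_fun of_coordE /kdeg sub0set cards0 xjoin0 lexx.
Qed.

(** At [w = x] the simplex has no vertex and the empty set survives: that coefficient is what the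
    augmentation reads. For [w] strictly above [x] the homotopy applies again. *)
Lemma kaug_exact (v : kmod 0) : kaug v = 0 <-> exists u, kdiff 0 u = v.
Proof.
have d0x (u : kmod 1) : coord (kdiff_fun u) set0 x = 0.
  rewrite kdiffE /kbd big1 // => j /setDP[jS _].
  by rewrite coord_eq0 ?mulr0 // xjoinU (negPf (S_nle jS)) andbF.
split=> [av|[u <-]]; last by rewrite /= /kaug_fun d0x kscale0.
have vx : coord v set0 x = 0 by apply: (kscale_inj t0); rewrite kscale0.
exists (khom_fun v); apply: coord_ext => I w.
have [/andP[D Iw]|nI] := boolP (kdeg 0 I && (xjoin I <= w)%O); last first.
  by rewrite !coord_eq0.
have I0 : I = set0 by apply/eqP; rewrite -cards_eq0; case/andP: D.
rewrite {}I0 {D} xjoin0 in Iw *.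
have [wx|xw] := eqVneq w x; first by rewrite wx vx; exact: d0x.
have [p pS wp] : exists2 p, p \in S & kpick w = Some p.
  by apply: kpick_gt; rewrite lt_def xw.
rewrite kdiffE -[RHS](kbd_homotopy (fun J => coord v J w) set0 pS).
rewrite [X in _ = _ + X](_ : _ = 0) ?addr0; last by rewrite /khomotopy inE.
by apply: eq_bigr => j _; rewrite (khomE _ _ wp).
Qed.

Definition koszul_resolution : proj_resolution M :=
  @ProjResolution A^c M kmod kdiff kaug
    (fun n => @proj_sum_projective K d R {set R} (kdeg n) xjoin)
    kaug_surj kaug_exact kmod_exact.

End Augmentation.
End KoszulResolution.

(** Both sides sum over pairs of a set and an element to be adjoined or removed. [kcobd] does not
    mention [S], so [c] has to vanish off the subsets of [S]. *)
Lemma kbd_adjoint (K : comPzRingType) (T : finType) (S : {set T})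
    (f c : {set T} -> K) :
  (forall I : {set T}, ~~ (I \subset S) -> c I = 0) ->
  \sum_I f I * kbd S c I = \sum_I kcobd f I * c I.
Proof.
move=> cS; rewrite /kbd /kcobd.
under eq_bigr do rewrite mulr_sumr.
under [RHS]eq_bigr do rewrite mulr_suml.
rewrite (exchange_big_dep xpredT) //= [RHS](exchange_big_dep xpredT) //=.
apply: eq_bigr => j _.
rewrite (reindex_onto (fun I : {set T} => I :\ j)
  (fun I : {set T} => j |: I)) /=; last first.
  by move=> I /setDP[_ jI]; rewrite setU1K.
rewrite [RHS](bigID [pred I | j \in S]) /= [X in _ = _ + X]big1 ?addr0; last first.
  move=> I /andP[jI jS]; rewrite cS ?mulr0 //.
  by apply: contra jS => /subsetP; apply.
apply: eq_big => [I|I /andP[_ /eqP jI]].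
  rewrite !inE eqxx /= andbC; congr andb.
  apply/eqP/idP => [<-|jI]; first exact: setU11.
  exact: setD1K.
by rewrite jI mulrA (mulrC (f _)).
Qed.

(** * Ext of a simple module from its Koszul resolution *)

Section KoszulExt.
Variables (K : fieldType) (d : Order.disp_t) (R : finTBLatticeType d).
Notation A := (incidence_alg K R).
Variables (x : R) (S : {set R}).
Hypothesis S_nle : forall p, p \in S -> ~~ (p <= x)%O.
Hypothesis S_lt : forall w, (x < w)%O -> exists2 p, p \in S & (p <= w)%O.
Hypothesis S_join : forall (z : R) (I : {set R}), I \subset S ->
  (z <= xjoin x S)%O ->
  (z <= xjoin x I)%O = [forall p in S :\: I, ~~ (p <= z)%O].
Implicit Types (I J : {set R}) (p z : R).

Variables (M : lmodType A^c) (t : M).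
Hypothesis t0 : t != 0.
Hypothesis tZ : forall a : A, (a : A^c) *: t = kscale (val a (x, x) : K) t.
Hypothesis t_gen : forall u, exists k : K, u = kscale k t.

Notation Q := (koszul_resolution S_nle S_lt t0 tZ t_gen).
Notation kmod := (kmod K x S).

Lemma xjoin_mono I J : I \subset J -> (xjoin x I <= xjoin x J)%O.
Proof.
move=> /subsetP IJ; rewrite xjoin_le xjoin_ge; apply/forall_inP => i /IJ iJ.
by have := lexx (xjoin x J); rewrite xjoin_le => /andP[_ /forall_inP]; apply.
Qed.

Lemma hom_coord_pull n (g : homA (kmod n)) z I : kdeg S n.+1 I ->
  hom_coord (hom_pull (kdiff K x S n) g) z I = kcobd (fun J => hom_coord g z J) I.
Proof.
move=> DI; rewrite /hom_coord hom_pullE [LHS]hom_coordE.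
under eq_bigr do rewrite [coord _ _ _]kdiffE.
rewrite kbd_adjoint => [|J JS]; last by rewrite coord_eq0 // /kdeg (negPf JS).
rewrite (bigD1 I) //= big1 => [|J JI].
  by rewrite coord_gen DI !eqxx mulr1 addr0.
by rewrite coord_gen (negPf JI) andbF mulr0.
Qed.

Lemma cocycle_kcobd n (f : homA (kmod n)) z I :
  f \in @cocycle A M Q n -> kdeg S n.+1 I -> kcobd (fun J => hom_coord f z J) I = 0.
Proof.
move=> /asboolP fc DI; rewrite -hom_coord_pull // /hom_coord hom_pullE.
by have /= -> := fc (gen K (kdeg S n.+1) (xjoin x) I); rewrite ffunE.
Qed.

(** By [S_join], for [z] below [xjoin x S], the component at [z] lives on the sets [I] containing
    every element of [S] below [z]. If some [p] in [S] is not below [z], inserting or deleting [p]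
    preserves this condition and [kcohomotopy p] contracts the component. *)
Lemma cocycle_coboundary n (f : homA (kmod n)) :
  f \in @cocycle A M Q n ->
  (forall z I, (forall p, p \in S -> (p <= z)%O) -> hom_coord f z I = 0) ->
  f \in @coboundary A M Q n.
Proof.
move=> fc f0; pose G z := if [pick p in S | ~~ (p <= z)%O] is Some p
  then kcohomotopy p (fun J => hom_coord f z J) else fun=> 0.
have GE z I : kdeg S n I -> hom_coord f z I = kcobd (G z) I.
  rewrite /G => DI; case: pickP => [p /andP[pS pz]|Sz]; last first.
    rewrite f0 => [|p pS]; last by have := Sz p; rewrite pS => /negbFE.
    by rewrite /kcobd big1 // => j _; rewrite mulr0.
  rewrite -[LHS](kcobd_homotopy p) -[RHS]addr0; congr (_ + _).
  rewrite /kcohomotopy; case: ifPn => // pI.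
  by rewrite cocycle_kcobd ?mulr0 // kdegU // pS.
have f_eq g : (forall z I, kdeg S n I -> hom_coord f z I = hom_coord g z I) -> f = g.
  move=> fg; apply: hom_coord_ext => z I.
  by have [/fg //|nD] := boolP (kdeg S n I); rewrite !hom_coord_eq0 ?(negPf nD).
case: n => [|n] in f fc f0 @G GE f_eq *.
  apply/eqP/f_eq => z I DI; rewrite GE // [RHS]/hom_coord -[val _ _]/0 ffunE.
  rewrite /kcobd big1 // => j.
  by case/andP: DI => _; rewrite cards_eq0 => /eqP->; rewrite inE.
(* The primitive defines a homomorphism only if it is supported on [z <= xjoin x I]; since [p] is
   not below [z], [S_join] allows dropping [p] from [p |: I]. *)
have G_supp z I : ~~ (z <= xjoin x I)%O -> G z I = 0.
  rewrite /G; case: pickP => // p /andP[pS pz] nzI.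
  rewrite /kcohomotopy; case: ifPn => // pI; rewrite hom_coord_eq0 ?mulr0 //.
  apply: contra nzI => /andP[]; rewrite kdegU // pS /= => /andP[IS _] zI.
  have pIS : p |: I \subset S by rewrite subUset sub1set pS.
  have zS := le_trans zI (xjoin_mono pIS).
  move: zI; rewrite (S_join pIS zS) (S_join IS zS) => /forall_inP h.
  apply/forall_inP => q /setDP[qS qI]; have [->//|qp] := eqVneq q p.
  by apply: h; rewrite !inE negb_or qp qI.
apply/asboolP; exists (of_hom_coord (kdeg S n) G_supp) => v.
rewrite -[RHS]/(val (hom_pull (kdiff K x S n) (of_hom_coord (kdeg S n) G_supp)) v).
congr (val _ v); apply: f_eq => z I DI; rewrite GE // hom_coord_pull //.
apply: eq_bigr => j jI; rewrite of_hom_coordE //.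
by move: DI; rewrite -{1}(setD1K jI) kdegU ?inE ?eqxx // => /andP[].
Qed.

(** Only components at [z] above all of [S] could survive, and there [S_join] forces [I] to contain
    [S], which is too large in degree [i]. *)
Lemma koszul_Ext_eq0 i (e : Ext Q i) : (i < #|S|)%N -> e = 0.
Proof.
move=> iS; have [c ->] := ext_class_surj e; apply/quot_pi_eq0.
apply: cocycle_coboundary; first exact: (valP c).
move=> z I Sz; have [/andP[/andP[IS /eqP Ii] zI]|] :=
  boolP (kdeg S i I && (z <= xjoin x I)%O); last exact: hom_coord_eq0.
have zS := le_trans zI (xjoin_mono IS).
move: zI; rewrite (S_join IS zS) => /forall_inP h.
have /subsetPn[p pS pI] : ~~ (S \subset I).
  by apply: contraL iS => /subset_leq_card; rewrite Ii -leqNgt.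
by have := h p; rewrite inE pS pI Sz // => /(_ isT).
Qed.

Variable y : R.
Hypothesis y_le : forall z, (y <= z)%O = [forall p in S, (p <= z)%O].

Lemma y_le_xjoin : (y <= xjoin x S)%O.
Proof.
rewrite y_le; have := lexx (xjoin x S); rewrite {1}xjoin_le => /andP[_].
by [].
Qed.

Let k := #|S|.

Lemma kdeg_card I : kdeg S k I = (I == S).
Proof.
rewrite /kdeg /k; case IS: (I \subset S); last by rewrite eqEsubset IS.
by rewrite (subset_leqif_cards IS).2.
Qed.

Lemma top_cocycle (f : homA (kmod k)) : f \in @cocycle A M Q k.
Proof.
apply/asboolP=> v; rewrite (_ : res_diff Q k v = 0) ?homA0 //.
apply: coord_ext => I w; rewrite coord0 [LHS]kdiffE /kbd big1 // => j jI.
rewrite coord_eq0 ?mulr0 //; apply/negP => /andP[/andP[/subset_leq_card]].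
by move=> jS /eqP jk; rewrite jk ltnn in jS.
Qed.

Definition top_class (f : homA (kmod k)) : Ext Q k :=
  ext_class (Submod (@cocycle A M Q k) (top_cocycle f)).

Lemma top_class_surj (e : Ext Q k) : exists f, e = top_class f.
Proof.
have [c ->] := ext_class_surj e; exists (val c); congr ext_class.
exact: val_inj.
Qed.

Lemma top_class_linear (a : A) f g :
  top_class (a *: f + g) = a *: top_class f + top_class g.
Proof.
rewrite /top_class /ext_class -quot_piZ -quot_piD.
congr (quot_pi _ _); exact: Submod_linear.
Qed.

Lemma top_class0 : top_class 0 = 0.
Proof. by apply/quot_pi_eq0; exact: rpred0. Qed.

Lemma hom_coord_linear n (a : A) (f g : homA (kmod n)) z I :
  hom_coord (a *: f + g) z I =
  \sum_u (val a (z, u) : K) * hom_coord f u I + hom_coord g z I.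
Proof. by rewrite /hom_coord homA_valD homA_valZ inc_addE inc_mulrE. Qed.

Lemma hom_coord_klinear n (c : K) (f g : homA (kmod n)) z I :
  hom_coord ((c *: (1 : A)) *: f + g) z I = c * hom_coord f z I + hom_coord g z I.
Proof.
rewrite hom_coord_linear.
under eq_bigr do rewrite inc_scaleE inc_1E.
rewrite (bigD1 z) //= big1 => [|u uz]; first by rewrite addr0 eqxx mulr1.
by rewrite eq_sym (negPf uz) mulr0 mul0r.
Qed.

(** The coboundary at [S] involves the sets [S :\ j], whose coordinates at [y] vanish by [S_join]
    because [j <= y]. Thus this coordinate is well defined on [Ext]. *)
Lemma coboundary_hom_coord (f : homA (kmod k)) :
  f \in @coboundary A M Q k -> hom_coord f y S = 0.
Proof.
have: kdeg S k S by rewrite kdeg_card.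
move: k f => [|n] f DS; first by move=> /eqP->; rewrite /hom_coord ffunE.
move=> /asboolP[g fg]; have -> : f = hom_pull (kdiff K x S n) g.
  by apply: val_inj; apply: funext => v; rewrite fg.
rewrite hom_coord_pull // /kcobd big1 // => j jS.
rewrite hom_coord_eq0 ?mulr0 // negb_and; apply/orP; right.
rewrite (S_join (subsetDl S [set j]) y_le_xjoin).
apply/forall_inPn; exists j; first by rewrite !inE eqxx.
by rewrite negbK; have := lexx y; rewrite {1}y_le => /forall_inP; apply.
Qed.

(** The coordinate at [y], the bottom of the interval supporting [Ext]. The left action moves
    coordinates downwards, so [y] carries the socle and this functional generates the dual. *)
Definition socle_fun (e : Ext Q k) : K := hom_coord (val (repr e)) y S.

Lemma socle_funE f : socle_fun (top_class f) = hom_coord f y S.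
Proof.
have /ext_class_eq E : ext_class (repr (top_class f)) = top_class f.
  exact: quot_pi_repr.
rewrite /socle_fun -[val (repr _)](subrK f) -[X in X + f]scale1r.
by rewrite -[1]scale1r hom_coord_klinear coboundary_hom_coord ?mulr0 ?add0r.
Qed.

Fact socle_subproof : socle_fun \in @dual_pred K d R (Ext Q k).
Proof.
apply/asboolP=> c u v; have [f ->] := top_class_surj u.
have [g ->] := top_class_surj v.
by rewrite -top_class_linear !socle_funE hom_coord_klinear.
Qed.

Definition socle : dual (Ext Q k) :=
  @exist _ (fun phi => phi \in @dual_pred K d R (Ext Q k)) _ socle_subproof.

Lemma basis_supp z z' I : ~~ (z' <= xjoin x I)%O ->
  ((z' == z) && (z <= xjoin x I)%O)%:R = 0 :> K.
Proof. by case: eqP => // ->; case: (_ <= _)%O. Qed.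

Definition basis z : homA (kmod k) := of_hom_coord (kdeg S k) (basis_supp z).

Lemma basisE z z' : hom_coord (basis z) z' S = ((z' == z) && (z <= xjoin x S)%O)%:R.
Proof. by rewrite of_hom_coordE // kdeg_card. Qed.

Lemma homA_basis (f : homA (kmod k)) :
  f = \sum_z ((hom_coord f z S *: (1 : A) : A) *: basis z).
Proof.
have coord_sum (c : R -> K) z I :
    hom_coord (\sum_u (c u *: (1 : A) : A) *: basis u) z I =
    \sum_u c u * hom_coord (basis u) z I.
  elim/big_rec2: _ => [|i u w _ <-]; first by rewrite /hom_coord ffunE.
  exact: hom_coord_klinear.
apply: hom_coord_ext => z I; have [->|IS] := eqVneq I S; last first.
  by rewrite !hom_coord_eq0 // kdeg_card (negPf IS).
rewrite coord_sum (bigD1 z) //= big1 => [|u uz].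
  rewrite addr0 basisE eqxx /=; have [_|nzS] := boolP (z <= _)%O.
    by rewrite mulr1.
  by rewrite hom_coord_eq0 ?mul0r // negb_and nzS orbT.
by rewrite basisE eq_sym (negPf uz) mulr0.
Qed.

Lemma basis_class_eq0 z : ~~ (y <= z)%O -> top_class (basis z) = 0.
Proof.
move=> nyz; apply/quot_pi_eq0; apply: cocycle_coboundary => [|z' I Sz'].
  exact: top_cocycle.
have [DI|nD] := boolP (kdeg S k I); last by rewrite hom_coord_eq0 ?(negPf nD).
rewrite of_hom_coordE //; case: eqP => // z'z.
by case/negP: nyz; rewrite y_le -z'z; apply/forall_inP.
Qed.

Lemma socle_generates (phi : dual (Ext Q k)) :
  exists a : A, phi = (a : A^c) *: socle.
Proof.
(* Acting on [socle], row [y] of [a] pairs with the coordinates of a class, so its entries must be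
   the values of [phi] on basis classes. Putting 0 where [y] is not below [z] is harmless by
   [basis_class_eq0]. *)
pose aF : {ffun R * R -> K^o} := [ffun p =>
  if (p.1 == y) && (y <= p.2)%O then val phi (top_class (basis p.2)) else 0].
have aP : aF \in @incidence_pred K d R.
  apply/incidence_predP => u z nuz; rewrite ffunE /=.
  by case: eqP => //= <-; rewrite (negPf nuz).
pose a : A := @exist _ (fun f => f \in @incidence_pred K d R) _ aP.
have phiE f : val phi (top_class f) =
    \sum_z hom_coord f z S * val phi (top_class (basis z)).
  rewrite {1}[f]homA_basis.
  elim/big_rec2: _ => [|i u w _ <-]; last by rewrite top_class_linear dual_linear.
  by rewrite top_class0 dual0.
exists a; apply: val_inj; apply: funext => e; have [f ->] := top_class_surj e.
rewrite dual_rscalerE -[a *: _]addr0.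
rewrite -top_class0 -top_class_linear [RHS]socle_funE hom_coord_linear.
rewrite [X in _ + X]ffunE addr0.
rewrite phiE; apply: eq_bigr => z _; rewrite ffunE /= eqxx mulrC /=.
case: ifPn => // /basis_class_eq0 ->.
by rewrite dual0.
Qed.

Lemma koszul_Ext_local : local_at y (dual (Ext Q k)).
Proof.
exists socle; split; last exact: socle_generates.
  apply/eqP => /(congr1 (fun phi : dual _ => val phi (top_class (basis y)))) /eqP.
  by rewrite [X in X == _]socle_funE basisE eqxx y_le_xjoin oner_eq0.
apply: val_inj; apply: funext => e; have [f ->] := top_class_surj e.
rewrite dual_rscalerE -[_ *: top_class _]addr0.
rewrite -top_class0 -top_class_linear [LHS]socle_funE [RHS]socle_funE.
rewrite hom_coord_linear.
rewrite [X in _ + X]ffunE addr0 (bigD1 y) //= big1 => [|u uy].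
  by rewrite addr0 inc_idemE !eqxx mul1r.
by rewrite inc_idemE eqxx (negPf uy) mul0r.
Qed.

End KoszulExt.

(** * Rowmotion *)

Section MinimalMaximal.
Variables (d : Order.disp_t) (R : finTBLatticeType d).
Implicit Types (x y z w p q m : R).

Definition min_nle x : {set R} :=
  [set p | ~~ (p <= x)%O && [forall q, (q < p)%O ==> (q <= x)%O]].

Definition max_nge x : {set R} :=
  [set m | ~~ (x <= m)%O && [forall q, (m < q)%O ==> (x <= q)%O]].

Lemma min_nleP x p :
  reflect (~~ (p <= x)%O /\ forall q, (q < p)%O -> (q <= x)%O) (p \in min_nle x).
Proof.
rewrite inE; apply: (iffP andP) => -[npx h]; split=> //.
  by move=> q; apply/implyP; apply: (forallP h).
by apply/forallP => q; apply/implyP/h.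
Qed.

Lemma max_ngeP x m :
  reflect (~~ (x <= m)%O /\ forall q, (m < q)%O -> (x <= q)%O) (m \in max_nge x).
Proof.
rewrite inE; apply: (iffP andP) => -[npx h]; split=> //.
  by move=> q; apply/implyP; apply: (forallP h).
by apply/forallP => q; apply/implyP/h.
Qed.

Lemma min_nle_exists x w : ~~ (w <= x)%O -> exists2 p, p \in min_nle x & (p <= w)%O.
Proof.
move=> nwx; pose P q := ~~ (q <= x)%O && (q <= w)%O.
have Pw : P w by rewrite /P nwx lexx.
case: (arg_minnP (fun q => #|[set r | (r <= q)%O]|) Pw) => p /andP[npx pw] pmin.
exists p => //; apply/min_nleP; split=> // q qp; apply: contraTT (qp) => nqx.
have := pmin q; rewrite /P nqx (le_trans (ltW qp) pw) => /(_ isT).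
rewrite leqNgt; apply: contraNN => _; apply/proper_card/properP; split.
  by apply/subsetP => r; rewrite !inE => /le_trans; apply; exact: ltW.
by exists p; rewrite inE // lt_geF.
Qed.

Lemma max_nge_exists x w : ~~ (x <= w)%O -> exists2 m, m \in max_nge x & (w <= m)%O.
Proof.
move=> nxw; pose P q := ~~ (x <= q)%O && (w <= q)%O.
have Pw : P w by rewrite /P nxw lexx.
case: (arg_minnP (fun q => #|[set r | (q <= r)%O]|) Pw) => m /andP[nxm wm] mmin.
exists m => //; apply/max_ngeP; split=> // q mq; apply: contraTT (mq) => nxq.
have := mmin q; rewrite /P nxq (le_trans wm (ltW mq)) => /(_ isT).
rewrite leqNgt; apply: contraNN => _; apply/proper_card/properP; split.
  by apply/subsetP => r; rewrite !inE; apply: le_trans; exact: ltW.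
by exists m; rewrite inE // lt_geF.
Qed.

Lemma min_nle_antichain x p q :
  p \in min_nle x -> q \in min_nle x -> (p <= q)%O -> p = q.
Proof.
move=> /min_nleP[npx _] /min_nleP[_ qmin]; rewrite le_eqVlt => /orP[/eqP//|pq].
by rewrite (qmin p pq) in npx.
Qed.

Definition corowmotion x : R := (\join_(p in min_nle x) p)%O.

Definition rowmotion x : R := (\meet_(m in max_nge x) m)%O.

Section Distributive.
Hypothesis distR : distributive_lattice R.

(** Distributivity splits [p] as the join of its meets with [a] and [b]. If both were strictly below
    [p], both would lie below [x], and so would [p]. *)
Lemma min_nle_prime x p a b :
  p \in min_nle x -> (p <= a `|` b)%O = (p <= a)%O || (p <= b)%O.
Proof.
move=> /min_nleP[npx pmin]; apply/idP/orP => [pab|[/lexUl->//|/lexUr->//]].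
have pE : p = ((p `&` a) `|` (p `&` b))%O.
  by rewrite -distR; apply/esym/meet_idPl.
have [pa|npa] := boolP (p <= a)%O; first by left.
have [pb|npb] := boolP (p <= b)%O; first by right.
case/negP: npx; rewrite pE leUx !pmin // lt_leAnge leIl /= lexI lexx.
  by rewrite (negPf npb).
by rewrite (negPf npa).
Qed.

Lemma min_nle_prime_join x p (I : {set R}) :
  p \in min_nle x -> (p <= x `|` \join_(i in I) i)%O ->
  exists2 i, i \in I & (p <= i)%O.
Proof.
move=> pS; have /min_nleP[npx _] := pS.
rewrite (min_nle_prime _ _ pS) (negPf npx) /=.
elim/big_rec: _ => [/le_trans/(_ (le0x x))|i z iI IH]; first by rewrite (negPf npx).
rewrite (min_nle_prime _ _ pS) => /orP[pi|/IH//].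
by exists i.
Qed.

Lemma meet_joins_distr z (I : {set R}) :
  (z `&` \join_(i in I) i = \join_(i in I) (z `&` i))%O.
Proof.
elim/big_rec2: _ => [|i u v _ IH]; first exact: meetx0.
by rewrite distR IH.
Qed.

(** Supplies [S_join]. One direction is primality in an antichain; for the other, distribute [z]
    over the join and note that [z] meets each [i] outside [I] strictly below [i], hence below
    [x]. *)
Lemma xjoin_min_nle x z (I : {set R}) : I \subset min_nle x ->
  (z <= xjoin x (min_nle x))%O ->
  (z <= xjoin x I)%O = [forall p in min_nle x :\: I, ~~ (p <= z)%O].
Proof.
move=> /subsetP IS zS; apply/idP/forall_inP => [zI p /setDP[pS pI]|h].
  apply: contra pI => pz; have [i iI pi] := min_nle_prime_join pS (le_trans pz zI).
  by rewrite (min_nle_antichain pS (IS i iI) pi).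
have -> : z = ((z `&` x) `|` \join_(i in min_nle x) (z `&` i))%O.
  by rewrite -meet_joins_distr -distR; apply/esym/meet_idPl.
rewrite leUx; apply/andP; split; first exact: le_trans (leIr _ _) (leUl _ _).
apply/joinsP => i iS; have [iI|iI] := boolP (i \in I).
  by apply: le_trans (leIr _ _) (le_trans _ (leUr _ _)); exact: joins_sup.
apply: le_trans (leUl _ _); have /min_nleP[_] := iS; apply.
rewrite lt_leAnge leIr lexI lexx andbT.
by apply: h; rewrite inE iI iS.
Qed.

Lemma corowmotion_le x z :
  (corowmotion x <= z)%O = [forall p in min_nle x, (p <= z)%O].
Proof. by apply/joinsP/forall_inP. Qed.

Lemma min_nle_gt x w : (x < w)%O -> exists2 p, p \in min_nle x & (p <= w)%O.
Proof. by move=> xw; apply: min_nle_exists; rewrite lt_geF. Qed.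

Lemma rowmotionK x : rowmotion (corowmotion x) = x.
Proof.
apply: le_anti; apply/andP; split; last first.
  (* If [x] is not below [m], maximality puts [x] joined with [m] above [corowmotion x]; every [p]
     is prime and not below [x], hence below [m], a contradiction. *)
  apply/meetsP => m /max_ngeP[ncm mmax]; apply: contraNT ncm => nxm.
  have xm_ge : (corowmotion x <= x `|` m)%O.
    by apply: mmax; rewrite lt_leAnge leUr leUx lexx andbT.
  rewrite corowmotion_le; apply/forall_inP => p pS.
  move: xm_ge; rewrite corowmotion_le => /forall_inP/(_ p pS).
  by rewrite (min_nle_prime _ _ pS); have /min_nleP[/negPf-> _] := pS.
apply: contraT => /min_nle_exists[p pS p_row].
(* Joining all minimal elements except [p] stays off the filter of [corowmotion x]. A maximal such
   [m] above [m0] also lies above [rowmotion (corowmotion x)], hence above [p], and thus above all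
   of [min_nle x]. *)
pose m0 := xjoin x (min_nle x :\ p).
have npm0 : ~~ (p <= m0)%O.
  apply/negP => /(min_nle_prime_join pS)[q /setD1P[qp qS] pq].
  by rewrite (min_nle_antichain pS qS pq) eqxx in qp.
have [|m mM m0m] := @max_nge_exists (corowmotion x) m0.
  by rewrite corowmotion_le; apply/forall_inPn; exists p.
have /max_ngeP[/negP[]] := mM; rewrite corowmotion_le; apply/forall_inP => q qS.
have [->|qp] := eqVneq q p.
  by apply: le_trans p_row _; exact: meets_inf.
move: m0m; rewrite xjoin_le => /andP[_ /forall_inP]; apply.
exact/setD1P.
Qed.

Lemma corowmotion_inj : injective corowmotion.
Proof. exact: can_inj rowmotionK. Qed.

End Distributive.

Section FilterExpansion.
Variables (x : R) (f : R -> int).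
Hypothesis fE : forall w, \sum_(y | (w <= y)%O) f y = (x <= w)%O%:R.

Definition max_nge_closure u : R := (\meet_(m in max_nge x | (u <= m)%O) m)%O.

Lemma le_max_nge_closure u : (u <= max_nge_closure u)%O.
Proof. by apply/meetsP => m /andP[]. Qed.

Lemma le_closure u v : (u <= v)%O -> (max_nge_closure u <= max_nge_closure v)%O.
Proof.
move=> uv; apply/meetsP => m /andP[mM vm]; apply: meets_inf.
by rewrite mM (le_trans uv vm).
Qed.

(** Compare the expansions at [u] and at its closure: both right-hand sides agree, since [x <= u] if
    and only if [x] lies below the closure. By induction, the other [v] strictly above [u]
    contribute only if closed, and then they lie above the closure of [u]. What is left is
    [f u = 0]. *)
Lemma expansion_support u : f u != 0 -> u = max_nge_closure u.
Proof.
have [n] := ubnP #|[set v | (u <= v)%O]|.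
elim: n u => // n IH u; rewrite ltnS => un.
apply: contraNeq => u_cl.
have u_lt : (u < max_nge_closure u)%O.
  by rewrite lt_def eq_sym u_cl le_max_nge_closure.
have := fE u; rewrite (bigD1 u) //= => /(canRL (addrK _)) ->.
rewrite (bigID (fun v => (max_nge_closure u <= v)%O)) /=.
rewrite [X in _ - (_ + X)]big1 => [|v].
  rewrite addr0 (eq_bigl (fun v => (max_nge_closure u <= v)%O)) => [|v].
    rewrite fE subr_eq0; apply/eqP; congr (nat_of_bool _)%:R.
    apply/idP/idP => [xu|xcl]; first exact: le_trans xu (le_max_nge_closure u).
    apply: contraLR xcl => nxu; have [m mM um] := max_nge_exists nxu.
    have /max_ngeP[nxm _] := mM; apply: contra nxm => /le_trans; apply.
    by apply: meets_inf; rewrite mM um.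
  case: (boolP (max_nge_closure u <= v)%O) => [cv|_]; last by rewrite andbF.
  rewrite (le_trans (ltW u_lt) cv) andbT /=; apply/eqP => vu.
  by rewrite vu lt_geF in cv.
move=> /andP[/andP[uv vu] ncv]; apply/eqP; apply: contraNT ncv => fv.
rewrite (IH v) //; first exact: le_closure.
apply: leq_trans un; apply/proper_card/properP; split.
  by apply/subsetP => r; rewrite !inE; apply: le_trans.
by exists u; rewrite inE // lt_geF // lt_def vu.
Qed.

Lemma rowmotion_le_support u : f u != 0 -> (rowmotion x <= u)%O.
Proof.
move/expansion_support->; apply/meetsP => m /andP[mM _]; exact: meets_inf.
Qed.

(** The elements strictly above [m] are those above both [m] and [x]; their coefficients sum to 1,
    while the whole sum at [m] is 0. *)
Lemma expansion_max_nge m : m \in max_nge x -> f m = -1.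
Proof.
move=> /max_ngeP[nxm mmax].
have := fE m; rewrite (bigD1 m) //= (negPf nxm) => /(canRL (addrK _)) ->.
rewrite sub0r; congr (- _).
rewrite (eq_bigl (fun v => ((m `|` x) <= v)%O)) => [|v].
  by rewrite fE leUr.
rewrite leUx; case: (boolP (m <= v)%O) => //= mv; apply/idP/idP => [vm|xv].
  by apply: mmax; rewrite lt_def vm.
by apply: contraNneq nxm => <-.
Qed.

End FilterExpansion.
End MinimalMaximal.

(** * Leading entries of the Coxeter matrix *)

Section LeadingTerms.
Variables (d : Order.disp_t) (R : finTBLatticeType d).
Implicit Types (x y z w p q m u v : R).
Variables (f : R -> R -> int) (rk : R -> nat).
Hypothesis fE : forall x w, \sum_(y | (w <= y)%O) f x y = (x <= w)%O%:R.
Hypothesis rk_inj : injective rk.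
Hypothesis rk_lt : forall x y, (x < y)%O -> (rk x < rk y)%N.

(** In the style of Weisner's theorem: the sum over the filter of [v] vanishes and splits into
    fibres over the elements between [v] and [w]; all fibres but the one over [v] vanish by
    induction. *)
Lemma fiber_sum_eq0 x w v : ~~ (x <= w)%O -> (v <= w)%O ->
  \sum_(u | (u `&` w)%O == v) f x u = 0.
Proof.
move=> nxw; have [n] := ubnP #|[set u | (v <= u)%O]|.
elim: n v => // n IH v; rewrite ltnS => vn vw.
have: \sum_(u | (v <= u)%O) f x u = 0.
  rewrite fE; case: (boolP (x <= v)%O) => // /le_trans/(_ vw).
  by rewrite (negPf nxw).
rewrite (partition_big (fun u => u `&` w)%O (fun v' => (v <= v')%O && (v' <= w)%O)) /=.
  rewrite (bigD1 v) ?lexx ?vw //= [X in _ + X]big1 ?addr0 => [E|v'].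
    rewrite -[RHS]E; apply: eq_bigl => u.
    by case: eqP => [<-|_]; rewrite ?leIl ?andbT ?andbF.
  move=> /andP[/andP[vv' v'w] v'v]; rewrite -[RHS](IH v') //.
    apply: eq_bigl => u; case: eqP => [uw|_]; last by rewrite andbF.
    by rewrite andbT -[RHS]vv' -uw lexI vw andbT.
  apply: leq_trans vn; apply/proper_card/properP; split.
    by apply/subsetP => r; rewrite !inE; apply: le_trans.
  by exists v; rewrite inE // lt_geF // lt_def v'v.
by move=> u vu; rewrite leIr lexI vu vw.
Qed.

Definition lattice_prime w := exists x, forall u, (u <= w)%O = ~~ (x <= u)%O.

Lemma lattice_primeI w a b : lattice_prime w ->
  (a `&` b <= w)%O = (a <= w)%O || (b <= w)%O.
Proof. by move=> [x xE]; rewrite !xE lexI negb_and. Qed.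

(** If the nontrivial inequality failed, some element maximal among those not above the left side
    would lie above the right side; being prime, it would lie above the left side as well. *)
Lemma distributive_of_prime :
  (forall x w, w \in max_nge x -> lattice_prime w) -> distributive_lattice R.
Proof.
move=> prime_max x y z; apply: le_anti; apply/andP; split; last first.
  by rewrite leUx !leI2 ?leUl ?leUr.
apply: contraT => /max_nge_exists[m mM]; rewrite leUx => /andP[xy xz].
have /max_ngeP[/negP nm _] := mM; case: nm.
move: xy xz; rewrite !(lattice_primeI _ _ (prime_max _ _ mM)) leUx.
by case: (x <= m)%O => //= -> ->.
Qed.

Hypothesis lead : forall w, exists x,
  f x w != 0 /\ forall v, (rk v < rk w)%N -> f x v = 0.

(* If w, m are two maximal elements not above x and all of those but w are
   prime, then m is the only u with u `&` w = w `&` m that can contribute to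
   [fiber_sum_eq0]. *)
Lemma leading_unique x w m :
  (forall v, (rk v < rk w)%N -> f x v = 0) -> w \in max_nge x ->
  (forall m', m' \in max_nge x -> m' != w -> lattice_prime m') ->
  m \in max_nge x -> m = w.
Proof.
move=> fx0 wM primeM mM; apply: contraTeq isT => mw.
have max_anti a b : a \in max_nge x -> b \in max_nge x -> (a <= b)%O -> a = b.
  move=> /max_ngeP[_ amax] /max_ngeP[nxb _]; rewrite le_eqVlt => /orP[/eqP//|ab].
  by rewrite (amax b ab) in nxb.
have nwm : ~~ (w <= m)%O by apply: contraNN mw => /(max_anti _ _ wM mM)->.
have [nxw _] := max_ngeP _ _ wM.
have := fiber_sum_eq0 nxw (leIl w m).
rewrite (bigD1 m) /=; last by rewrite meetC.
rewrite (expansion_max_nge (fE x) mM) big1 // => u /andP[/eqP uw um].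
apply/eqP; apply: contraNT um => fu.
(* For [m' = w] the element [u] would be the meet of [w] and [m], which precedes [w], so its
   coefficient is 0. Otherwise [m'] is prime and lies above that meet, which forces it to be [m]. *)
have u_in m' : m' \in max_nge x -> (u <= m')%O -> m' = m.
  move=> m'M um'; have [m'w|m'w] := eqVneq m' w.
    have uE : u = (w `&` m)%O by rewrite -uw; apply/esym/meet_idPl; rewrite -m'w.
    case/eqP: fu; rewrite uE; apply/fx0/rk_lt.
    by rewrite lt_leAnge leIl lexI lexx (negPf nwm).
  have : (w `&` m <= m')%O by rewrite -uw (le_trans _ um') ?leIl.
  rewrite (lattice_primeI _ _ (primeM _ m'M m'w)) => /orP[wm'|mm'].
    by rewrite (max_anti _ _ wM m'M wm') eqxx in m'w.
  exact/esym/max_anti.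
have uE := expansion_support (fE x) fu.
have mu : (m <= u)%O by rewrite uE; apply/meetsP => m' /andP[m'M /(u_in _ m'M)->].
rewrite eq_le mu andbT; apply: contraT => num.
(* No maximal element is above [u], so its closure is an empty meet, the top; then [w] equals its
   meet with [m], contradicting [nwm]. *)
have : max_nge_closure x u = \top%O.
  rewrite /max_nge_closure big_pred0 // => m'; apply/negP => /andP[m'M um'].
  by move: num; rewrite -(u_in _ m'M um') um'.
rewrite -uE => u1; rewrite u1 meet1x in uw.
by rewrite uw leIr in nwm.
Qed.

(** Descending induction along [rk]: later elements are known to be prime first. The witness is the
    row led by [w], which need not be the given [x]. *)
Lemma leading_prime x w : w \in max_nge x -> lattice_prime w.
Proof.
have [N] := ubnP (\max_u rk u - rk w).
elim: N x w => // N IH x0 w; rewrite ltnS => wN wM0.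
have [x [fw fx0]] := lead w; have /max_ngeP[nx0w w_up] := wM0.
(* A nonzero coefficient makes [w] a meet of elements of [max_nge x]. Were they all strictly above
   [w], they would lie above [x0], and so would [w]. *)
have wM : w \in max_nge x.
  apply: contraNT nx0w => wM; rewrite (expansion_support (fE x) fw).
  apply/meetsP => m /andP[mM wm]; apply: w_up; rewrite lt_def wm andbT.
  by apply: contraNneq wM => <-.
(* Any other [m'] has coefficient -1, so it cannot precede the leading position [w]; it comes later
   and the induction hypothesis applies. *)
have only_w m : m \in max_nge x -> m = w.
  apply: leading_unique => // m' m'M m'w; apply: (IH x) => //.
  apply: leq_trans wN; have m'_le := leq_bigmax (F := rk) m'.
  suff: (rk w < rk m')%N by move=> wm'; rewrite ltn_sub2l // (leq_trans wm').
  rewrite ltn_neqAle (inj_eq rk_inj) eq_sym m'w leqNgt.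
  by apply/negP => /fx0; rewrite (expansion_max_nge (fE x) m'M).
exists x => u; apply/idP/idP => [uw|/max_nge_exists[m /only_w->] //].
by have /max_ngeP[nxw _] := wM; apply: contra nxw => /le_trans; apply.
Qed.

Lemma leading_distributive : distributive_lattice R.
Proof. exact: distributive_of_prime leading_prime. Qed.

End LeadingTerms.

(** * The Coxeter matrix along a linear extension *)

Section CoxeterMatrix.
Variables (d : Order.disp_t) (R : finTBLatticeType d).
Variables (n : nat) (s : 'I_n -> R) (rk : R -> 'I_n).
Hypotheses (sK : cancel s rk) (rkK : cancel rk s).
Hypothesis s_lt : forall i j : 'I_n, (s i < s j)%O -> (i < j)%N.

Let s_inj : injective s := can_inj sK.

Lemma s_le i j : (s i <= s j)%O -> (i <= j)%N.
Proof.
by rewrite le_eqVlt => /orP[/eqP/s_inj->//|/s_lt/ltnW].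
Qed.

Lemma cartan_unit : cartan_mx s \in unitmx.
Proof.
rewrite unitmxE det_trig.
  by rewrite big1 // => i _; rewrite mxE lexx.
apply/is_trig_mxP => i j ij; rewrite mxE.
by case: (boolP (_ <= _)%O) => // /s_le; rewrite leqNgt ij.
Qed.

Lemma coxeter_unit : coxeter_mx s \in unitmx.
Proof.
rewrite /coxeter_mx -scaleN1r unitmxZ ?unitrN1 //.
by rewrite unitmx_mul unitmx_tr unitmx_inv cartan_unit.
Qed.

(** This is [C *m omega = - omega^T] entrywise, since multiplying by the Cartan matrix on the right
    sums over principal filters. *)
Lemma coxeter_expansion x w :
  \sum_(y | (w <= y)%O) - coxeter_mx s (rk x) (rk y) = (x <= w)%O%:R.
Proof.
have E : (coxeter_mx s *m cartan_mx s) (rk x) (rk w) = - (x <= w)%O%:R.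
  by rewrite mulNmx mulmxKV ?cartan_unit // !mxE !rkK.
rewrite -[RHS]opprK -E mxE -sumrN big_mkcond.
rewrite (reindex s) /=; last by exists rk => i _.
apply: eq_bigr => j _; rewrite sK !mxE rkK.
by case: ifP; rewrite ?mulr1 ?mulr0 ?oppr0.
Qed.

Lemma coxeter_top i : coxeter_mx s i (rk \top%O) != 0.
Proof.
have := coxeter_expansion (s i) \top%O; rewrite lex1 sK.
rewrite (eq_bigl (pred1 \top%O)) => [|y]; last by rewrite le1x.
by rewrite big_pred1_eq => /eqP; apply: contraTneq => ->.
Qed.

Lemma first_nonzero_exists i : exists j, first_nonzero (coxeter_mx s) i j.
Proof.
have [j Cj jmin] := @arg_minnP _ _ [pred j | coxeter_mx s i j != 0]
  (fun j => j) (coxeter_top i).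
exists j; apply/andP; split=> //; apply/forallP=> k; apply/implyP => kj.
by apply: contraTT kj => /jmin; rewrite -leqNgt.
Qed.

Lemma coxeter_leading_distributive :
  leading_columns_distinct (coxeter_mx s) -> distributive_lattice R.
Proof.
move=> lcd; have /choice[lead leadP] := first_nonzero_exists.
have lead_inj : injective lead.
  move=> i j ij; apply/eqP; apply: contraTT isT => nij.
  by have := lcd _ _ _ _ nij (leadP i) (leadP j); rewrite ij eqxx.
apply: (@leading_distributive _ _ _ (fun x => rk x : nat) coxeter_expansion).
- by move=> x y /val_inj/(can_inj rkK).
- by move=> x y xy; apply: s_lt; rewrite !rkK.
(* An injective self-map of a finite set is onto, so every column leads some row. *)
move=> w; have [row _ rowK] := injF_bij lead_inj.
exists (s (row (rk w))); rewrite sK.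
have := leadP (row (rk w)); rewrite rowK => /andP[Cw /forallP C0].
split=> [|v vw]; first by rewrite oppr_eq0.
by have := C0 (rk v); rewrite vw => /eqP->; rewrite oppr0.
Qed.

Hypothesis distR : distributive_lattice R.

Fact corow_index_inj : injective (fun i => rk (corowmotion (s i))).
Proof.
by move=> i j /(can_inj rkK)/(corowmotion_inj distR)/s_inj.
Qed.

(** Assigns to a column the row whose leading entry lies in it; see [coxeter_perm_leading]. *)
Definition coxeter_perm : 'S_n := perm corow_index_inj.

Lemma coxeter_permE i : s (coxeter_perm i) = corowmotion (s i).
Proof. by rewrite permE rkK. Qed.

Lemma coxeter_perm_support i k :
  coxeter_mx s (coxeter_perm i) k != 0 -> (i <= k)%N.
Proof.
move=> Ck; apply: s_le; rewrite -[s i](rowmotionK distR) -coxeter_permE.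
apply: (rowmotion_le_support (coxeter_expansion _)).
by rewrite !sK oppr_eq0.
Qed.

Lemma coxeter_upper : is_trig_mx (row_perm coxeter_perm (coxeter_mx s))^T.
Proof.
apply/is_trig_mxP => i j ij; rewrite 2!mxE; apply/eqP; apply: contraTT ij.
by move=> /coxeter_perm_support; rewrite -leqNgt.
Qed.

Lemma coxeter_perm_leading i : first_nonzero (coxeter_mx s) (coxeter_perm i) i.
Proof.
apply/andP; split.
  have : row_perm coxeter_perm (coxeter_mx s) \in unitmx.
    (* The permuted matrix is invertible and triangular, so its determinant is the product of its
       diagonal and no diagonal entry can be 0. *)
    by rewrite row_permE unitmx_mul unitmx_perm coxeter_unit.
  rewrite unitmxE -det_tr (det_trig coxeter_upper) => U.
  apply/eqP => C0; move: U; rewrite (bigD1 i) //= 2!mxE C0 mul0r.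
  by rewrite unitr0.
apply/forallP=> k; apply/implyP; apply: contraTT => Ck.
by rewrite -leqNgt; exact: coxeter_perm_support.
Qed.

Lemma first_nonzero_unique i j1 j2 :
  first_nonzero (coxeter_mx s) i j1 -> first_nonzero (coxeter_mx s) i j2 -> j1 = j2.
Proof.
move=> /andP[n1 /forallP h1] /andP[n2 /forallP h2]; apply: val_inj.
case: (ltngtP j1 j2) => // lt12.
  by have := h2 j1; rewrite lt12 (negPf n1).
by have := h1 j2; rewrite lt12 (negPf n2).
Qed.

Lemma coxeter_distributive_leading : leading_columns_distinct (coxeter_mx s).
Proof.
move=> i1 i2 j1 j2; rewrite -[i1](permKV coxeter_perm) -[i2](permKV coxeter_perm).
move=> i12 /(first_nonzero_unique (coxeter_perm_leading _))<-.
move=> /(first_nonzero_unique (coxeter_perm_leading _))<-.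
by rewrite (inj_eq perm_inj) in i12.
Qed.

Lemma coxeter_bruhat (F : realFieldType) :
  bruhat_decomposition (map_mx intr (coxeter_mx s)) 1%:M
    (perm_mx coxeter_perm^-1 : 'M[F]_n)
    (map_mx intr (row_perm coxeter_perm (coxeter_mx s))).
Proof.
split.
- by apply/is_trig_mxP => i j ij; rewrite !mxE; case: eqP ij => // ->; rewrite ltnn.
- by apply/is_perm_mxP; eexists.
- apply/is_trig_mxP => i j ij; rewrite !mxE.
  by have /is_trig_mxP/(_ i j ij) := coxeter_upper; rewrite !mxE => ->.
rewrite mul1mx -row_permE; apply/matrixP => i j.
by rewrite !mxE permKV.
Qed.

Lemma coxeter_col_perm (F : realFieldType) :
  col_perm_of (perm_mx coxeter_perm^-1 : 'M[F]_n) coxeter_perm.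
Proof. by move=> i; rewrite !mxE permK eqxx oner_eq0. Qed.

End CoxeterMatrix.

(** The Koszul computation applies with [S = min_nle x], the grade being the size of this set.
    Distributivity enters through [xjoin_min_nle]. *)
Lemma corowmotion_grade_bijection (K : fieldType) (d : Order.disp_t)
    (R : finTBLatticeType d) (distR : distributive_lattice R) :
  is_grade_bijection K (perm (corowmotion_inj distR)).
Proof.
move=> x; rewrite permE; have [t [t0 tZ t_gen]] := simple_mod_simple_at K x.
have S_nle p : p \in min_nle x -> ~~ (p <= x)%O by case/min_nleP.
have S_join z I := @xjoin_min_nle _ R distR x z I.
apply: (@grade_image_of_resolution _ _ _ _ _
  (koszul_resolution S_nle (@min_nle_gt _ R x) t0 tZ t_gen) #|min_nle x|).
  by move=> i ? e; exact: koszul_Ext_eq0.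
exact: koszul_Ext_local (@corowmotion_le _ R x).
Qed.

(** A nonempty finite lattice is bounded, hence [finTBLatticeType]. The Bruhat decomposition is
    taken over any real field [F], and the incidence algebra over any field [K]. *)
Theorem theorem1p4 (d : Order.disp_t) (R : finTBLatticeType d)
    (n : nat) (s : 'I_n -> R) (hs : linear_extension s)
    (F : realFieldType) (K : fieldType) :
  (distributive_lattice R <-> leading_columns_distinct (coxeter_mx s)) /\
  (distributive_lattice R ->
   exists (P U2 : 'M[F]_n) (pi : 'S_n) (phi : {perm R}),
     [/\ bruhat_decomposition (map_mx intr (coxeter_mx s)) 1%:M P U2,
         col_perm_of P pi,
         is_grade_bijection K phi
       & forall i : 'I_n, phi (s i) = s (pi i)]).
Proof.
have [[rk sK rkK] s_lt] := hs.
split; first split.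
- exact: coxeter_distributive_leading sK rkK s_lt.
- exact: coxeter_leading_distributive sK rkK s_lt.
move=> distR; exists (perm_mx (coxeter_perm sK rkK distR)^-1).
exists (map_mx intr (row_perm (coxeter_perm sK rkK distR) (coxeter_mx s))).
exists (coxeter_perm sK rkK distR), (perm (corowmotion_inj distR)); split.
- exact: coxeter_bruhat.
- exact: coxeter_col_perm.
- exact: corowmotion_grade_bijection.
by move=> i; rewrite permE coxeter_permE.
Qed.
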